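(* Let $A$ be an Artinian algebra over a field $k$ with radical $r_A$, let $\{S_1,\dots,S_s\}$ be the complete set of non-isomorphic irreducible $A$-modules, and let $D_i=\mathrm{End}_A(S_i)$ for $i=1,\dots,s$. Let $A/r_A=\bigoplus_{i=1}^sA_i$ with $A_i\cong M_{n_i}(D_i)$ the simple component corresponding to $S_i$. Let $B$ be the basic algebra of $A$ with radical $r_B$, so that $B/r_B=\prod_{i=1}^sD_i$. Let $t^A_{ij}$ (resp. $t^B_{ij}$) be the number of arrows from $i$ to $j$ in the natural quiver $\Delta_A$ (resp. $\Delta_B$), and let $h^A_{ij}$ (resp. $h^B_{ij}$) be the number of arrows from $i$ to $j$ in the diagram $D_A$ (resp. $D_B$). Then for all $i,j=1,\dots,s$: (i) $t^A_{ij}\le \left\lceil \dfrac{t^B_{ij}}{n_in_j}\right\rceil\le t^B_{ij}$; (ii) $t^A_{ij}\le \left\lceil \dfrac{h^A_{ij}}{n_in_j}\right\rceil\le t^A_{ij}\,\dim_kD_i$.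
   Context: Artinian means left Artinian; modules are left modules; $D_i=\mathrm{End}_A(S_i)$ is a division algebra acting on $S_i$ from the right (endomorphisms written on the right), so that $A_i\cong M_{n_i}(D_i)$. $\lceil a\rceil$ is the least integer $\geq a$. The dimension $\dim_kD_i$ may be infinite, in which case the right-hand side of (ii) is $\infty$ if $t^A_{ij}>0$ and $0$ if $t^A_{ij}=0$. Natural quiver of an Artinian algebra $A$: vertices $1,\dots,s$; the number of arrows from $i$ to $j$ is the minimal number of generators of $A_j\cdot(r_A/r_A^2)\cdot A_i$ as an $A_j$-$A_i$-bimodule ($0$ if this bimodule is zero). Diagram $D_A$ of an Artinian algebra $A$: vertices $1,\dots,s$; let $P_i$ be the indecomposable projective $A$-module with $P_i/r_AP_i\cong S_i$; the semisimple module $V_i=r_AP_i/r_A^2P_i$ decomposes as $V_i\cong\bigoplus_{j=1}^sS_j^{\oplus h^A_{ij}}$, and there are exactly $h^A_{ij}$ arrows from $i$ to $j$. Basic algebra: choose primitive orthogonal idempotents $\varepsilon_1,\dots,\varepsilon_s\in A$ with $A\varepsilon_i\cong P_i$, put $\varepsilon=\sum_i\varepsilon_i$; then $B=\varepsilon A\varepsilon$, $r_B=\varepsilon r_A\varepsilon$. The vertex $i$ of $\Delta_B$ and $D_B$ corresponds to the simple component $D_i$ of $B/r_B$. *)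

(* Defs.v *)
From HB Require Import structures.
From mathcomp Require Import all_boot all_order all_algebra.
From mathcomp Require Import generic_quotient ring_quotient.
From mathcomp Require Import boolp classical_sets constructive_ereal.

Set Implicit Arguments.
Unset Strict Implicit.
Unset Printing Implicit Defensive.

Import Order.TTheory GRing.Theory Num.Theory.
Local Open Scope classical_set_scope.
Local Open Scope quotient_scope.
Local Open Scope ring_scope.

Definition additive_subgroup (V : zmodType) (G : set V) : Prop :=
  [/\ G 0, forall x y, G x -> G y -> G (x + y) & forall x, G x -> G (- x)].

Definition submodule (R : pzRingType) (M : lmodType R) (N : set M) : Prop :=
  [/\ N 0, forall x y, N x -> N y -> N (x + y)
    & forall (a : R) x, N x -> N (a *: x)].

Definition left_ideal (R : pzRingType) (I : set R) : Prop :=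
  @submodule R R^o I.

Definition two_sided_ideal (R : pzRingType) (I : set R) : Prop :=
  [/\ additive_subgroup I, forall a x, I x -> I (a * x)
    & forall a x, I x -> I (x * a)].

Definition left_artinian (R : pzRingType) : Prop :=
  forall I : nat -> set R,
    (forall n, left_ideal (I n)) -> (forall n, I n.+1 `<=` I n) ->
    exists N, forall n, (N <= n)%N -> I n = I N.

Definition maximal_left_ideal (R : pzRingType) (I : set R) : Prop :=
  [/\ left_ideal I, I <> setT
    & forall J, left_ideal J -> I `<=` J -> J = I \/ J = setT].

Lemma submodule_subgroup (R : pzRingType) (M : lmodType R) (N : set M) :
  submodule N -> additive_subgroup N.
Proof. by case=> N0 ND NZ; split=> // x Nx; rewrite -scaleN1r; apply: NZ. Qed.

Lemma submodule_bigcap (R : pzRingType) (M : lmodType R) (C : set (set M)) :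
  (forall N, C N -> submodule N) -> submodule (\bigcap_(N in C) N).
Proof.
move=> CP; split=> [N /CP[]|x y Nx Ny N CN|a x Nx N CN] //.
  by case: (CP N CN) => _ ND _; apply: ND; [apply: Nx | apply: Ny].
by case: (CP N CN) => _ _; apply; apply: Nx.
Qed.

Record submod (R : pzRingType) (M : lmodType R) := Submod {
  submod_set :> set M;
  submodP : submodule submod_set }.

Record ideal (R : pzRingType) := Ideal {
  ideal_set :> set R;
  idealP : two_sided_ideal ideal_set }.

Section ModuleQuotient.
Variables (R : pzRingType) (M : lmodType R) (N : submod M).

Definition submod_pred : {pred M} := fun x => `[< submod_set N x >].

Fact submod_pred_zmod : zmod_closed submod_pred.
Proof.
have [N0 ND NN] := submodule_subgroup (submodP N).
split=> [|x y /asboolP Nx /asboolP Ny]; apply/asboolP => //.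
by apply: ND => //; apply: NN.
Qed.
HB.instance Definition _ :=
  GRing.isZmodClosed.Build M submod_pred submod_pred_zmod.

Definition quotmod := {ideal_quot submod_pred}.
HB.instance Definition _ := GRing.Zmodule.on quotmod.
HB.instance Definition _ := EqQuotient.on quotmod.

Definition quotmod_scale (a : R) (x : quotmod) : quotmod :=
  \pi_quotmod (a *: repr x).

Lemma quotmod_eqP (x y : M) : \pi_quotmod x = \pi_quotmod y <-> submod_set N (x - y).
Proof.
split=> [/eqP|Nxy]; last by apply/eqP; rewrite -Quotient.idealrBE; apply/asboolP.
by rewrite -Quotient.idealrBE => /asboolP.
Qed.

Lemma pi_quotmodD (x y : M) :
  \pi_quotmod (x + y) = \pi_quotmod x + \pi_quotmod y.
Proof. exact: raddfD \pi_{ideal_quot submod_pred} x y. Qed.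

Lemma pi_quotmodZ (a : R) (x : M) :
  \pi_quotmod (a *: x) = quotmod_scale a (\pi_quotmod x).
Proof.
apply/quotmod_eqP; rewrite -scalerBr; case: (submodP N) => _ _; apply.
by apply/quotmod_eqP; rewrite reprK.
Qed.

Fact quotmod_scaleA a b v :
  quotmod_scale a (quotmod_scale b v) = quotmod_scale (a * b) v.
Proof.
by rewrite -[v]reprK -[quotmod_scale b _]pi_quotmodZ -!pi_quotmodZ scalerA.
Qed.
Fact quotmod_scale1 : left_id 1 quotmod_scale.
Proof. by move=> v; rewrite -[v in LHS]reprK -pi_quotmodZ scale1r reprK. Qed.
Fact quotmod_scaleDr : right_distributive quotmod_scale +%R.
Proof.
move=> a u v; rewrite -[u]reprK -[v]reprK -pi_quotmodD -!pi_quotmodZ scalerDr.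
by rewrite pi_quotmodD.
Qed.
Fact quotmod_scaleDl v : {morph quotmod_scale^~ v : a b / a + b}.
Proof.
by move=> a b; rewrite -[v]reprK -!pi_quotmodZ scalerDl pi_quotmodD.
Qed.
HB.instance Definition _ := GRing.Zmodule_isLmodule.Build R quotmod
  quotmod_scaleA quotmod_scale1 quotmod_scaleDr quotmod_scaleDl.

End ModuleQuotient.

Section AlgebraQuotient.
Variables (k : fieldType) (A : algType k) (I : ideal A).

Definition ideal_pred : {pred A} := fun x => `[< ideal_set I x >].

Fact ideal_pred_zmod : zmod_closed ideal_pred.
Proof.
have [[I0 ID IN] _ _] := idealP I.
split=> [|x y /asboolP Ix /asboolP Iy]; apply/asboolP => //.
by apply: ID => //; apply: IN.
Qed.
HB.instance Definition _ :=
  GRing.isZmodClosed.Build A ideal_pred ideal_pred_zmod.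

Definition quotalg := {ideal_quot ideal_pred}.
HB.instance Definition _ := GRing.Zmodule.on quotalg.
HB.instance Definition _ := EqQuotient.on quotalg.

Definition quotalg_mul (x y : quotalg) : quotalg :=
  \pi_quotalg (repr x * repr y).
Definition quotalg_scale (c : k) (x : quotalg) : quotalg :=
  \pi_quotalg (c *: repr x).

Lemma quotalg_eqP (x y : A) : \pi_quotalg x = \pi_quotalg y <-> ideal_set I (x - y).
Proof.
split=> [/eqP|Ixy]; last by apply/eqP; rewrite -Quotient.idealrBE; apply/asboolP.
by rewrite -Quotient.idealrBE => /asboolP.
Qed.

Lemma pi_quotalgD (x y : A) :
  \pi_quotalg (x + y) = \pi_quotalg x + \pi_quotalg y.
Proof. exact: raddfD \pi_{ideal_quot ideal_pred} x y. Qed.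

Lemma pi_quotalgM (x y : A) :
  \pi_quotalg (x * y) = quotalg_mul (\pi_quotalg x) (\pi_quotalg y).
Proof.
have [[_ ID _] IMl IMr] := idealP I.
apply/quotalg_eqP; set x' := repr _; set y' := repr _.
have Ix : ideal_set I (x - x') by apply/quotalg_eqP; rewrite reprK.
have Iy : ideal_set I (y - y') by apply/quotalg_eqP; rewrite reprK.
rewrite -[x * y](subrK (x' * y)) -addrA -mulrBl -mulrBr.
by apply: ID; [apply: IMr | apply: IMl].
Qed.

Lemma pi_quotalgZ (c : k) (x : A) :
  \pi_quotalg (c *: x) = quotalg_scale c (\pi_quotalg x).
Proof.
have [_ IMl _] := idealP I.
apply/quotalg_eqP; rewrite -scalerBr -mulr_algl; apply: IMl.
by apply/quotalg_eqP; rewrite reprK.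
Qed.

Fact quotalg_mulA : associative quotalg_mul.
Proof.
move=> x y z; rewrite -[x]reprK -[y]reprK -[z]reprK.
rewrite -(pi_quotalgM (repr y) (repr z)) -(pi_quotalgM (repr x) (repr y)).
by rewrite -!pi_quotalgM mulrA.
Qed.
Fact quotalg_mul1 : left_id (\pi_quotalg 1) quotalg_mul.
Proof. by move=> x; rewrite -[x]reprK -pi_quotalgM mul1r. Qed.
Fact quotalg_mulr1 : right_id (\pi_quotalg 1) quotalg_mul.
Proof. by move=> x; rewrite -[x]reprK -pi_quotalgM mulr1. Qed.
Fact quotalg_mulDl : left_distributive quotalg_mul +%R.
Proof.
move=> x y z; rewrite -[x]reprK -[y]reprK -[z]reprK -pi_quotalgD.
by rewrite -!pi_quotalgM mulrDl pi_quotalgD.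
Qed.
Fact quotalg_mulDr : right_distributive quotalg_mul +%R.
Proof.
move=> x y z; rewrite -[x]reprK -[y]reprK -[z]reprK -pi_quotalgD.
by rewrite -!pi_quotalgM mulrDr pi_quotalgD.
Qed.
HB.instance Definition _ := GRing.Zmodule_isPzRing.Build quotalg
  quotalg_mulA quotalg_mul1 quotalg_mulr1 quotalg_mulDl quotalg_mulDr.

Fact quotalg_scaleA a b v :
  quotalg_scale a (quotalg_scale b v) = quotalg_scale (a * b) v.
Proof.
by rewrite -[v]reprK -[quotalg_scale b _]pi_quotalgZ -!pi_quotalgZ scalerA.
Qed.
Fact quotalg_scale1 : left_id 1 quotalg_scale.
Proof. by move=> v; rewrite -[v in LHS]reprK -pi_quotalgZ scale1r reprK. Qed.
Fact quotalg_scaleDr : right_distributive quotalg_scale +%R.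
Proof.
move=> a u v; rewrite -[u]reprK -[v]reprK -pi_quotalgD -!pi_quotalgZ scalerDr.
by rewrite pi_quotalgD.
Qed.
Fact quotalg_scaleDl v : {morph quotalg_scale^~ v : a b / a + b}.
Proof.
by move=> a b; rewrite -[v]reprK -!pi_quotalgZ scalerDl pi_quotalgD.
Qed.
HB.instance Definition _ := GRing.Zmodule_isLmodule.Build k quotalg
  quotalg_scaleA quotalg_scale1 quotalg_scaleDr quotalg_scaleDl.

End AlgebraQuotient.

Section Radical.
Variable R : pzRingType.

Definition jacobson_set : set R :=
  \bigcap_(I in [set I | maximal_left_ideal I]) I.

Lemma maximal_left_ideal_colon (I : set R) (a : R) :
  maximal_left_ideal I ->
  [set x | I (x * a)] = setT \/ maximal_left_ideal [set x | I (x * a)].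
Proof.
move=> [[I0 ID IZ] IT Imax].
have colonP : left_ideal [set x | I (x * a)].
  split=> [|x y /= Ix Iy|b x /= Ix]; first by rewrite /= mul0r.
    by rewrite mulrDl; apply: ID.
  by rewrite -[b *: _]/(b * x) -mulrA; apply: IZ.
have [->|colonT] := pselect ([set x | I (x * a)] = setT); first by left.
right; split=> // J [J0 JD JZ] IJ.
pose J' := [set y : R | exists2 x, J x & I (y - x * a)].
have J'P : left_ideal J'.
  split=> [|y z [x Jx Ix] [x' Jx' Ix']|b y [x Jx Ix]].
  - by exists 0 => //; rewrite mul0r subr0.
  - exists (x + x'); first exact: JD.
    by rewrite mulrDl opprD addrACA; apply: ID.
  - exists (b * x); first exact: (JZ b x Jx).
    by rewrite -[b *: y]/(b * y) -mulrA -mulrBr; apply: (IZ b _ Ix).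
have IJ' : I `<=` J' by move=> y Iy; exists 0 => //; rewrite mul0r subr0.
have JNN x : J x -> J (- x).
  by move=> /(JZ (-1)); rewrite -[_ *: _]/(-1 * x) mulN1r.
have [J'I|J'T] := Imax _ J'P IJ'.
  left; apply/seteqP; split=> // x Jx /=; rewrite -J'I.
  by exists x => //; rewrite subrr.
right; apply/seteqP; split=> // y _.
have [x Jx Ixy] : J' (y * a) by rewrite J'T.
rewrite -[y](subrK x); apply: JD => //; apply: IJ => /=.
by rewrite mulrBl.
Qed.

Fact jacobson_ideal : two_sided_ideal jacobson_set.
Proof.
have jP : left_ideal jacobson_set.
  by apply: (@submodule_bigcap R R^o) => I [].
split; [exact: submodule_subgroup jP | by case: jP | ].
move=> a x jx I /= Imax.
have [IT|Imax'] := maximal_left_ideal_colon a Imax; last exact: (jx _ Imax').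
by have : [set x | I (x * a)] x by rewrite IT.
Qed.
Definition jacobson : ideal R := Ideal jacobson_ideal.

Fact ideal_square_ideal (I : ideal R) :
  two_sided_ideal
    (smallest (@two_sided_ideal R) [set x * y | x in I & y in I]).
Proof.
split; first split.
- by move=> J [[[]]].
- move=> x y Jx Jy J JP; have [[[_ JD _] _ _] _] := JP.
  by apply: JD; [apply: Jx | apply: Jy].
- by move=> x Jx J JP; have [[[_ _ JN] _ _] _] := JP; apply: JN; apply: Jx.
- by move=> a x Jx J JP; have [[_ Jl _] _] := JP; apply: Jl; apply: Jx.
- by move=> a x Jx J JP; have [[_ _ Jr] _] := JP; apply: Jr; apply: Jx.
Qed.
Definition ideal_square (I : ideal R) : ideal R :=
  Ideal (ideal_square_ideal I).

Fact ideal_act_submod (I : ideal R) (M : lmodType R) :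
  submodule
    (smallest (@submodule R M) [set a *: x | a in I & x in [set: M]]).
Proof. by apply: submodule_bigcap => N []. Qed.
Definition ideal_act (I : ideal R) (M : lmodType R) : submod M :=
  Submod (ideal_act_submod I M).

End Radical.
Arguments jacobson R : clear implicits.

Section Modules.
Variable R : pzRingType.

Definition mod_iso (M N : lmodType R) : Prop :=
  exists f : {linear M -> N}, bijective f.

Definition simple_module (M : lmodType R) : Prop :=
  (exists x : M, x != 0) /\
  forall N : set M, submodule N -> N = [set 0] \/ N = setT.

Definition projective_module (P : lmodType R) : Prop :=
  forall (M N : lmodType R) (g : {linear M -> N}) (f : {linear P -> N}),
    (forall y, exists x, g x = y) ->
    exists h : {linear P -> M}, forall x, g (h x) = f x.

Definition indecomposable_module (P : lmodType R) : Prop :=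
  (exists x : P, x != 0) /\
  forall U V : set P, submodule U -> submodule V ->
    (forall x, exists u v, [/\ U u, V v & x = u + v]) ->
    U `&` V = [set 0] -> U = [set 0] \/ V = [set 0].

Definition complete_simple_modules (s : nat) (S : 'I_s -> lmodType R) : Prop :=
  [/\ forall i, simple_module (S i),
      forall i j, mod_iso (S i) (S j) -> i = j
    & forall M : lmodType R, simple_module M -> exists i, mod_iso M (S i)].

(* [N], a submodule of [M], is isomorphic to the direct sum of the
   [S j]^(h j): the linear maps from such a finite direct sum to [M] are the
   [x |-> \sum_j \sum_l u j l (x j l)] with all the [u j l] linear. *)
Definition iso_sum_of_simples (s : nat) (S : 'I_s -> lmodType R)
    (M : lmodType R) (N : set M) (h : 'I_s -> nat) : Prop :=
  exists u : forall j, 'I_(h j) -> {linear S j -> M},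
  let f (x : forall j, 'I_(h j) -> S j) := \sum_j \sum_l u j l (x j l) in
  injective f /\ range f = N.

(* [V_i = r P_i / r^2 P_i] is taken inside [P_i / r^2 P_i]. *)
Definition is_diagram (s : nat) (S P : 'I_s -> lmodType R)
    (h : 'I_s -> 'I_s -> nat) : Prop :=
  forall i, let Q := quotmod (ideal_act (ideal_square (jacobson R)) (P i)) in
    iso_sum_of_simples S (\pi_Q @` ideal_act (jacobson R) (P i)) (h i).

End Modules.

Record endo (k : fieldType) (A : algType k) (S : lmodType A) := Endo {
  endo_fun :> S -> S;
  endo_linear : linear endo_fun }.

HB.instance Definition _ k A S := gen_eqMixin (@endo k A S).
HB.instance Definition _ k A S := gen_choiceMixin (@endo k A S).

Section Endomorphisms.
Variables (k : fieldType) (A : algType k) (S : lmodType A).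
Implicit Types f g h : endo S.

Lemma endoP f g : f =1 g -> f = g.
Proof.
case: f g => f f_lin [g g_lin] /= /funext fg; rewrite -fg in g_lin *.
by rewrite (Prop_irrelevance f_lin g_lin).
Qed.

Lemma endoD f : {morph f : x y / x + y}.
Proof. by move=> x y; rewrite -[x]scale1r (endo_linear f) !scale1r. Qed.
Lemma endo0 f : f 0 = 0.
Proof. by apply: (addIr (f 0)); rewrite -endoD !add0r. Qed.
Lemma endoZ f a x : f (a *: x) = a *: f x.
Proof. by rewrite -[a *: x]addr0 (endo_linear f) endo0 addr0. Qed.

Fact endo_zero_linear : linear (fun _ : S => 0 : S).
Proof. by move=> a x y; rewrite scaler0 addr0. Qed.
Fact endo_add_linear f g : linear (fun x => f x + g x).
Proof. by move=> a x y; rewrite !endo_linear scalerDr addrACA. Qed.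
Fact endo_opp_linear f : linear (fun x => - f x).
Proof. by move=> a x y; rewrite endo_linear scalerN opprD. Qed.
Fact endo_one_linear : linear (fun x : S => x).
Proof. by []. Qed.
Fact endo_mul_linear f g : linear (fun x => g (f x)).
Proof. by move=> a x y; rewrite !endo_linear. Qed.
Fact endo_scale_linear (c : k) f : linear (fun x => (c%:A : A) *: f x).
Proof.
move=> a x y; rewrite endo_linear scalerDr !scalerA.
by rewrite mulr_algl mulr_algr.
Qed.

Definition endo_zero := Endo endo_zero_linear.
Definition endo_add f g := Endo (endo_add_linear f g).
Definition endo_opp f := Endo (endo_opp_linear f).
Definition endo_one := Endo endo_one_linear.
(* Endomorphisms act on the right: [x (f g) = (x f) g]. *)
Definition endo_mul f g := Endo (endo_mul_linear f g).
Definition endo_scale c f := Endo (endo_scale_linear c f).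

Fact endo_addA : associative endo_add.
Proof. by move=> f g h; apply: endoP => x /=; rewrite addrA. Qed.
Fact endo_addC : commutative endo_add.
Proof. by move=> f g; apply: endoP => x /=; rewrite addrC. Qed.
Fact endo_add0 : left_id endo_zero endo_add.
Proof. by move=> f; apply: endoP => x /=; rewrite add0r. Qed.
Fact endo_addN : left_inverse endo_zero endo_opp endo_add.
Proof. by move=> f; apply: endoP => x /=; rewrite addNr. Qed.
HB.instance Definition _ := GRing.isZmodule.Build (endo S)
  endo_addA endo_addC endo_add0 endo_addN.

Fact endo_mulA : associative endo_mul.
Proof. by move=> f g h; apply: endoP. Qed.
Fact endo_mul1 : left_id endo_one endo_mul.
Proof. by move=> f; apply: endoP. Qed.
Fact endo_mulr1 : right_id endo_one endo_mul.
Proof. by move=> f; apply: endoP. Qed.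
Fact endo_mulDl : left_distributive endo_mul +%R.
Proof. by move=> f g h; apply: endoP => x; apply: endoD. Qed.
Fact endo_mulDr : right_distributive endo_mul +%R.
Proof. by move=> f g h; apply: endoP. Qed.
HB.instance Definition _ := GRing.Zmodule_isPzRing.Build (endo S)
  endo_mulA endo_mul1 endo_mulr1 endo_mulDl endo_mulDr.

Fact endo_scaleA a b f :
  endo_scale a (endo_scale b f) = endo_scale (a * b) f.
Proof. by apply: endoP => x /=; rewrite !scalerA mulr_algl scalerA. Qed.
Fact endo_scale1 : left_id 1 endo_scale.
Proof. by move=> f; apply: endoP => x /=; rewrite !scale1r. Qed.
Fact endo_scaleDr : right_distributive endo_scale +%R.
Proof. by move=> a f g; apply: endoP => x /=; rewrite scalerDr. Qed.
Fact endo_scaleDl f : {morph endo_scale^~ f : a b / a + b}.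
Proof. by move=> a b; apply: endoP => x /=; rewrite !scalerDl. Qed.
HB.instance Definition _ := GRing.Zmodule_isLmodule.Build k (endo S)
  endo_scaleA endo_scale1 endo_scaleDr endo_scaleDl.

End Endomorphisms.

Definition has_basis (k : fieldType) (V : lmodType k) (d : nat) : Prop :=
  exists b : 'I_d -> V, forall v, exists! c : 'rV[k]_d,
    v = \sum_i c 0 i *: b i.

(* [+oo] when [V] has no finite basis *)
Definition dimk (k : fieldType) (V : lmodType k) : \bar int :=
  xget +oo%E [set x | exists2 d : nat, has_basis V d & x = (d%:Z)%:E].

(* [Q] is the internal direct sum of the two-sided ideals [C i]. *)
Definition sum_of_ideals (Q : pzRingType) (s : nat) (C : 'I_s -> set Q) : Prop :=
  (forall i, two_sided_ideal (C i)) /\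
  forall x, exists! c : {ffun 'I_s -> Q},
    (forall i, C i (c i)) /\ x = \sum_i c i.

Section Components.
Variables (k : fieldType) (A : algType k) (I : ideal A).

(* The ideal [C] of [A / I] is isomorphic, as a (not a priori unital)
   k-algebra, to the ring [T] on which k acts by [sc]. *)
Definition ideal_iso (C : set (quotalg I)) (T : pzRingType)
    (sc : k -> T -> T) : Prop :=
  exists f : T -> quotalg I,
    [/\ {morph f : x y / x + y}, {morph f : x y / x * y},
        forall c x, f (sc c x) = c *: f x, injective f & range f = C].

End Components.

Definition matrix_scale (k : fieldType) (D : pzRingType) (n : nat)
    (dsc : k -> D -> D) (c : k) (M : 'M[D]_n) : 'M[D]_n := map_mx (dsc c) M.

(* [A / r] is the direct sum of its simple components [C i], the [i]-th one
   being that on which [S i] is a nonzero module, and [C i] is a full matrix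
   algebra over [D_i]. *)
Definition is_wedderburn (k : fieldType) (A : algType k) (s : nat)
    (S : 'I_s -> lmodType A) (n : 'I_s -> nat)
    (C : 'I_s -> set (quotalg (jacobson A))) : Prop :=
  [/\ sum_of_ideals C,
      forall i, exists (a : A) (x : S i),
        C i (\pi_(quotalg (jacobson A)) a) /\ a *: x != 0
    & forall i, ideal_iso (C i)
        (@matrix_scale k (endo (S i)) (n i) (fun c d => c *: d))].

Section NaturalQuiver.
Variables (k : fieldType) (A : algType k).
Local Notation r := (jacobson A).
Local Notation Q1 := (quotalg r).
Local Notation Q2 := (quotalg (ideal_square r)).

(* [r / r^2] is the image of [r] in [A / r^2]; the class in [A / r] of [a]
   acts on it as left or right multiplication by the class in [A / r^2] of
   [a]. *)
Definition sub_bimodule (CL CR : set Q1) (W : set Q2) : Prop :=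
  [/\ W `<=` \pi_Q2 @` r, additive_subgroup W,
      forall (a : A) w, CL (\pi_Q1 a) -> W w -> W (\pi_Q2 a * w)
    & forall (a : A) w, CR (\pi_Q1 a) -> W w -> W (w * \pi_Q2 a)].

(* [CL . (r / r^2) . CR] *)
Definition arrow_bimodule (CL CR : set Q1) : set Q2 :=
  smallest (@additive_subgroup Q2)
    [set w | exists a x b, [/\ CL (\pi_Q1 a), ideal_set r x, CR (\pi_Q1 b)
                             & w = \pi_Q2 (a * x * b)]].

Definition generated_by (CL CR : set Q1) (W : set Q2) (t : nat) : Prop :=
  exists w : 'I_t -> Q2,
    range w `<=` W /\ W = smallest (sub_bimodule CL CR) (range w).

Definition min_generators (CL CR : set Q1) (W : set Q2) (t : nat) : Prop :=
  generated_by CL CR W t /\ forall m, generated_by CL CR W m -> (t <= m)%N.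

Definition is_natural_quiver (s : nat) (C : 'I_s -> set Q1)
    (t : 'I_s -> 'I_s -> nat) : Prop :=
  forall i j, min_generators (C j) (C i) (arrow_bimodule (C j) (C i)) (t i j).

End NaturalQuiver.

Record idempotent_elt (R : nzRingType) := IdempotentElt {
  idem_val :> R;
  idem_mul : idem_val * idem_val = idem_val;
  idem_neq0 : idem_val != 0 }.

Section Corner.
Variables (k : fieldType) (A : algType k) (u : idempotent_elt A).
Local Notation e := (idem_val u : A).

Definition in_corner : pred A := fun x => e * x * e == x.

(* The algebra [e A e], with unit [e]. *)
Definition corner : Type := {x : A | in_corner x}.
HB.instance Definition _ := [isSub of corner for @sval A in_corner].
HB.instance Definition _ := [Choice of corner by <:].

Fact in_corner_submod : submod_closed in_corner.
Proof.
split=> [|a x y]; rewrite -!topredE /= /in_corner; first by rewrite mulr0 mul0r.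
by move=> /eqP ex /eqP ey; rewrite mulrDr mulrDl -scalerAr -scalerAl ex ey.
Qed.
HB.instance Definition _ :=
  GRing.isSubmodClosed.Build k A in_corner in_corner_submod.
HB.instance Definition _ := [SubChoice_isSubLmodule of corner by <:].

Lemma cornerP (x : A) : in_corner (e * x * e).
Proof. by apply/eqP; rewrite !mulrA idem_mul -!mulrA idem_mul. Qed.
Definition to_corner (x : A) : corner := Sub (e * x * e) (cornerP x).

Lemma corner_l (x : corner) : e * val x = val x.
Proof. by rewrite -(eqP (valP x)) !mulrA idem_mul. Qed.
Lemma corner_r (x : corner) : val x * e = val x.
Proof. by rewrite -(eqP (valP x)) -!mulrA idem_mul. Qed.

Lemma corner_mulP (x y : corner) : in_corner (val x * val y).
Proof. by rewrite /in_corner mulrA corner_l -mulrA corner_r. Qed.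
Definition corner_mul (x y : corner) : corner :=
  Sub (val x * val y) (corner_mulP x y).
Lemma corner_oneP : in_corner e.
Proof. by rewrite /in_corner !idem_mul. Qed.
Definition corner_one : corner := Sub e corner_oneP.

Fact corner_mulA : associative corner_mul.
Proof. by move=> x y z; apply: val_inj; rewrite /= mulrA. Qed.
Fact corner_mul1 : left_id corner_one corner_mul.
Proof. by move=> x; apply: val_inj; rewrite /= corner_l. Qed.
Fact corner_mulr1 : right_id corner_one corner_mul.
Proof. by move=> x; apply: val_inj; rewrite /= corner_r. Qed.
Fact corner_mulDl : left_distributive corner_mul +%R.
Proof. by move=> x y z; apply: val_inj; rewrite /= mulrDl. Qed.
Fact corner_mulDr : right_distributive corner_mul +%R.
Proof. by move=> x y z; apply: val_inj; rewrite /= mulrDr. Qed.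
Fact corner_neq0 : corner_one != 0.
Proof. by rewrite -val_eqE /= idem_neq0. Qed.
HB.instance Definition _ := GRing.Zmodule_isNzRing.Build corner
  corner_mulA corner_mul1 corner_mulr1 corner_mulDl corner_mulDr corner_neq0.

Fact corner_scaleAl (c : k) (x y : corner) : c *: (x * y) = (c *: x) * y.
Proof. by apply: val_inj; rewrite /= scalerAl. Qed.
HB.instance Definition _ :=
  GRing.Lmodule_isLalgebra.Build k corner corner_scaleAl.
Fact corner_scaleAr (c : k) (x y : corner) : c *: (x * y) = x * (c *: y).
Proof. by apply: val_inj; rewrite /= scalerAr. Qed.
HB.instance Definition _ :=
  GRing.Lalgebra_isAlgebra.Build k corner corner_scaleAr.

End Corner.

Definition primitive_idempotent (R : pzRingType) (e : R) : Prop :=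
  [/\ e * e = e, e != 0
    & forall f g : R, f * f = f -> g * g = g -> f * g = 0 -> g * f = 0 ->
        e = f + g -> f = 0 \/ g = 0].

Definition left_ideal_iso (R : pzRingType) (P : lmodType R) (e : R) : Prop :=
  exists f : {linear P -> R^o}, injective f /\ range f = [set a * e | a in setT].

Definition basic_idempotents (R : pzRingType) (s : nat)
    (P : 'I_s -> lmodType R) (eps : 'I_s -> R) : Prop :=
  [/\ forall i, primitive_idempotent (eps i),
      forall i j, i != j -> eps i * eps j = 0
    & forall i, left_ideal_iso (P i) (eps i)].

(* [B / r_B] is the product of the [D_i], the [i]-th factor being the simple
   component of [B / r_B] that contains the class of [eps i]. *)
Definition is_basic_wedderburn (k : fieldType) (A : algType k) (s : nat)
    (S : 'I_s -> lmodType A) (eps : 'I_s -> A) (e : idempotent_elt A)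
    (C : 'I_s -> set (quotalg (jacobson (corner e)))) : Prop :=
  [/\ sum_of_ideals C,
      forall i, C i (\pi_(quotalg (jacobson (corner e))) (to_corner e (eps i)))
    & forall i, ideal_iso (C i) (fun (c : k) (d : endo (S i)) => c *: d)].

(* Main.v *)
(* Write r for the radical and V = eps_j (r / r^2) eps_i, a bimodule over the
   division rings D_j and D_i.  The bimodule A_j (r / r^2) A_i consists of the
   n_j x n_i matrices over V, so n_i n_j generators of V can be packed into one
   generator of it, and conversely the entries of a generator generate V; hence
   its minimal number of generators is t^B / (n_i n_j), rounded up.  Moreover
   h^A is the dimension of V over D_j, which is at least its number of
   generators as a bimodule and at most dim_k D_i times that number.
   Sub-bimodules are handled as two-sided ideals of A between r^2 and r, which
   makes the idempotents of A_j interchangeable. *)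
Require Import Defs.
From HB Require Import structures.
From mathcomp Require Import all_boot all_order all_algebra.
From mathcomp Require Import generic_quotient ring_quotient.
From mathcomp Require Import boolp classical_sets constructive_ereal.

Set Implicit Arguments.
Unset Strict Implicit.
Unset Printing Implicit Defensive.

Import Order.TTheory GRing.Theory Num.Theory.
Local Open Scope classical_set_scope.
Local Open Scope quotient_scope.
Local Open Scope ring_scope.

(** The data relate each component to a matrix algebra only by some isomorphism, with no
    compatibility between [eps j] and the matrix units. The link is the top of the projective: [S j]
    is cyclic on the class of [eps j], and its simplicity provides, for every [a] with [a * eps j]
    outside [r], some [a'] with [a' * a * eps j] congruent to [eps j] modulo [r]. This left inverse
    yields matrix units adapted to [eps j], row elimination over [D_j], and the comparison of the
    radicals of [A] and of the corner. In the bound on [h^A], right multiplication by [D_i] has to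
    be rewritten as left combinations. Coefficients over a k-basis of [D_i] are scalars of [k],
    hence central, and can be moved to the left of a generator; the basis elements cannot, which is
    where the factor [dim_k D_i] comes from. *)

Lemma ideal0 (R : pzRingType) (I : ideal R) : ideal_set I 0.
Proof. by case: (idealP I) => -[]. Qed.

Lemma ideal_add (R : pzRingType) (I : ideal R) x y :
  ideal_set I x -> ideal_set I y -> ideal_set I (x + y).
Proof. by case: (idealP I) => -[_ ID _] _ _; apply: ID. Qed.

Lemma ideal_opp (R : pzRingType) (I : ideal R) x :
  ideal_set I x -> ideal_set I (- x).
Proof. by case: (idealP I) => -[_ _ IN] _ _; apply: IN. Qed.

Lemma ideal_mull (R : pzRingType) (I : ideal R) a x :
  ideal_set I x -> ideal_set I (a * x).
Proof. by case: (idealP I) => _ IM _; apply: IM. Qed.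

Lemma ideal_mulr (R : pzRingType) (I : ideal R) a x :
  ideal_set I x -> ideal_set I (x * a).
Proof. by case: (idealP I) => _ _; apply. Qed.

Lemma ideal_sum (R : pzRingType) (I : ideal R) (T : Type) (s : seq T)
    (Q : pred T) (F : T -> R) :
  (forall i, Q i -> ideal_set I (F i)) ->
  ideal_set I (\sum_(i <- s | Q i) F i).
Proof.
move=> IF; elim/big_ind: _ => //; [exact: ideal0 | exact: ideal_add].
Qed.

Lemma ideal_congr_sym (R : pzRingType) (I : ideal R) x y :
  ideal_set I (x - y) -> ideal_set I (y - x).
Proof. by move=> /ideal_opp; rewrite opprB. Qed.

Lemma ideal_congr_trans (R : pzRingType) (I : ideal R) y x z :
  ideal_set I (x - y) -> ideal_set I (y - z) -> ideal_set I (x - z).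
Proof. by move=> xy yz; rewrite -(subrKA y); apply: ideal_add. Qed.

Lemma ideal_congr_mem (R : pzRingType) (I : ideal R) y x :
  ideal_set I (x - y) -> ideal_set I y -> ideal_set I x.
Proof. by move=> xy Iy; rewrite -[x](subrK y); apply: ideal_add. Qed.

Lemma ideal_congr_sum (R : pzRingType) (I : ideal R) (T : Type) (s : seq T)
    (Q : pred T) (F G : T -> R) :
  (forall i, Q i -> ideal_set I (F i - G i)) ->
  ideal_set I (\sum_(i <- s | Q i) F i - \sum_(i <- s | Q i) G i).
Proof. by move=> FG; rewrite -sumrB; apply: ideal_sum. Qed.

(** * The square of an ideal and the ideals above it *)

Lemma ideal_squareM (R : pzRingType) (I : ideal R) x y :
  ideal_set I x -> ideal_set I y -> ideal_set (ideal_square I) (x * y).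
Proof. by move=> Ix Iy; apply: sub_gen_smallest; exists x => //; exists y. Qed.

Lemma ideal_square_min (R : pzRingType) (I : ideal R) (J : set R) :
  two_sided_ideal J -> (forall x y, ideal_set I x -> ideal_set I y -> J (x * y)) ->
  ideal_set (ideal_square I) `<=` J.
Proof.
by move=> JP IJ; apply: smallest_sub => // _ [x Ix [y Iy <-]]; apply: IJ.
Qed.

Lemma ideal_square_sub (R : pzRingType) (I : ideal R) :
  ideal_set (ideal_square I) `<=` ideal_set I.
Proof. by apply: ideal_square_min (idealP I) _ => x y Ix _; apply: ideal_mulr. Qed.

(** This is the action of [R / I] on [I / I^2] on representatives: the scalar matters only modulo
    [I], the vector only modulo [I^2]. *)
Lemma square_congrM (R : pzRingType) (I : ideal R) a a' x y :
  ideal_set I (a - a') -> ideal_set I x -> ideal_set (ideal_square I) (x - y) ->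
  ideal_set (ideal_square I) (a * x - a' * y).
Proof.
move=> aa' Ix xy; apply: (@ideal_congr_trans _ _ (a' * x)).
  by rewrite -mulrBl; apply: ideal_squareM.
by rewrite -mulrBr; apply: ideal_mull.
Qed.

Lemma square_congrMr (R : pzRingType) (I : ideal R) a a' x y :
  ideal_set I (a - a') -> ideal_set I x -> ideal_set (ideal_square I) (x - y) ->
  ideal_set (ideal_square I) (x * a - y * a').
Proof.
move=> aa' Ix xy; apply: (@ideal_congr_trans _ _ (x * a')).
  by rewrite -mulrBr; apply: ideal_squareM.
by rewrite -mulrBl; apply: ideal_mulr.
Qed.

Lemma two_sided_ideal_bigcap (R : pzRingType) (C : set (set R)) :
  (forall J, C J -> two_sided_ideal J) -> two_sided_ideal (\bigcap_(J in C) J).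
Proof.
move=> CP; split; first split.
- by move=> J /CP [[]].
- move=> x y Jx Jy J CJ; have [[_ JD _] _ _] := CP J CJ.
  by apply: JD; [apply: Jx | apply: Jy].
- by move=> x Jx J CJ; have [[_ _ JN] _ _] := CP J CJ; apply: JN; apply: Jx.
- by move=> a x Jx J CJ; have [_ Jl _] := CP J CJ; apply: Jl; apply: Jx.
- by move=> a x Jx J CJ; have [_ _ Jr] := CP J CJ; apply: Jr; apply: Jx.
Qed.

Fact gen_ideal_two_sided (R : pzRingType) (X : set R) :
  two_sided_ideal (smallest (@two_sided_ideal R) X).
Proof. by apply: two_sided_ideal_bigcap => J []. Qed.

Definition gen_ideal (R : pzRingType) (X : set R) : ideal R :=
  Ideal (gen_ideal_two_sided X).

(* The ideal generated by [I^2] and the [w l]; for [w l] in [I] it stands for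
   the sub-bimodule of [I / I^2] that the classes of the [w l] generate. *)
Definition square_ext (R : pzRingType) (I : ideal R) (T : Type) (w : T -> R) :=
  gen_ideal (ideal_set (ideal_square I) `|` range w).

Lemma square_ext_sq (R : pzRingType) (I : ideal R) T (w : T -> R) :
  ideal_set (ideal_square I) `<=` ideal_set (square_ext I w).
Proof. by move=> x Ix; apply: sub_gen_smallest; left. Qed.

Lemma square_ext_gen (R : pzRingType) (I : ideal R) T (w : T -> R) l :
  ideal_set (square_ext I w) (w l).
Proof. by apply: sub_gen_smallest; right; exists l. Qed.

Lemma square_ext_min (R : pzRingType) (I J : ideal R) T (w : T -> R) :
  ideal_set (ideal_square I) `<=` ideal_set J -> (forall l, ideal_set J (w l)) ->
  ideal_set (square_ext I w) `<=` ideal_set J.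
Proof.
move=> IJ wJ; apply: smallest_sub; first exact: idealP.
by move=> x [/IJ //|[l _ <-]].
Qed.

Lemma square_ext_congr (R : pzRingType) (I : ideal R) T (w : T -> R) x y :
  ideal_set (ideal_square I) (x - y) -> ideal_set (square_ext I w) y ->
  ideal_set (square_ext I w) x.
Proof. by move=> /square_ext_sq xy; apply: ideal_congr_mem. Qed.

(** * Classes modulo an ideal of an algebra *)

Lemma pi_quotalg0 (k : fieldType) (A : algType k) (I : ideal A) :
  \pi_(quotalg I) (0 : A) = 0.
Proof. exact: raddf0 \pi_{ideal_quot ideal_pred I}. Qed.

Lemma pi_quotalg_opp (k : fieldType) (A : algType k) (I : ideal A) (x : A) :
  \pi_(quotalg I) (- x) = - \pi_(quotalg I) x.
Proof. exact: raddfN \pi_{ideal_quot ideal_pred I} x. Qed.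

Lemma pi_quotalg_mul (k : fieldType) (A : algType k) (I : ideal A) (x y : A) :
  \pi_(quotalg I) (x * y) = \pi_(quotalg I) x * \pi_(quotalg I) y.
Proof. exact: pi_quotalgM. Qed.

Lemma pi_quotalg_sum (k : fieldType) (A : algType k) (I : ideal A) (T : Type)
    (l : seq T) (F : T -> A) :
  \pi_(quotalg I) (\sum_(i <- l) F i) = \sum_(i <- l) \pi_(quotalg I) (F i).
Proof. exact: (big_morph _ (@pi_quotalgD k A I) (@pi_quotalg0 k A I)). Qed.

Lemma pi_quotalg_eq0 (k : fieldType) (A : algType k) (I : ideal A) (x : A) :
  \pi_(quotalg I) x = 0 <-> ideal_set I x.
Proof. by rewrite -(pi_quotalg0 I) quotalg_eqP subr0. Qed.

Lemma pi_mem (k : fieldType) (A : algType k) (I : ideal A)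
    (C : set (quotalg I)) : two_sided_ideal C ->
  two_sided_ideal [set a | C (\pi_(quotalg I) a)].
Proof.
case=> -[C0 CD CN] CMl CMr; split; first split=> [|x y Cx Cy|x Cx] /=.
- by rewrite pi_quotalg0.
- by rewrite pi_quotalgD; apply: CD.
- by rewrite pi_quotalg_opp; apply: CN.
- by move=> a x Cx /=; rewrite pi_quotalg_mul; apply: CMl.
- by move=> a x Cx /=; rewrite pi_quotalg_mul; apply: CMr.
Qed.

Definition preim_ideal (k : fieldType) (A : algType k) (I : ideal A)
  (C : set (quotalg I)) (CP : two_sided_ideal C) : ideal A := Ideal (pi_mem CP).

Lemma preim_ideal_sub (k : fieldType) (A : algType k) (I : ideal A)
    (C : set (quotalg I)) (CP : two_sided_ideal C) :
  ideal_set I `<=` ideal_set (preim_ideal CP).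
Proof.
move=> x Ix /=; have /quotalg_eqP -> : ideal_set I (x - 0) by rewrite subr0.
exact: (ideal0 (preim_ideal CP)).
Qed.

(** * The Jacobson radical and tops of projective modules *)

Lemma jacobson_left_inverse (R : pzRingType) (z : R) :
  ideal_set (jacobson R) z -> exists c, c * (1 - z) = 1.
Proof.
move=> jz; apply: contrapT => nc.
pose P (X : set R) := X = set0 \/ [/\ left_ideal X, X (1 - z) & ~ X 1].
have [F FP Ftot|M [PM Mmax]] := @Zorn_bigcup _ P.
  have [[X FX X1]|F0] := pselect (exists2 X, F X & X (1 - z)); last first.
    left; apply/seteqP; split=> // x [X FX Xx].
    by case: (FP X FX) => [X0|[_ X1 _]]; [rewrite X0 in Xx | apply: F0; exists X].
  right; have FPi Y y : F Y -> Y y -> [/\ left_ideal Y, Y (1 - z) & ~ Y 1].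
    by move=> FY Yy; case: (FP Y FY) => // Y0; rewrite Y0 in Yy.
  split; first split.
  - by exists X => //; case: (FPi X _ FX X1) => -[].
  - move=> x y [Y FY Yx] [Z FZ Zy]; case: (Ftot Y Z FY FZ) => YZ.
      exists Z => //; case: (FPi Z y FZ Zy) => -[_ ZD _] _ _.
      by apply: ZD => //; apply: YZ.
    exists Y => //; case: (FPi Y x FY Yx) => -[_ ZD _] _ _.
    by apply: ZD => //; apply: YZ.
  - move=> a x [Y FY Yx]; exists Y => //; case: (FPi Y x FY Yx) => -[_ _ YZ] _ _.
    exact: YZ.
  - by exists X.
  - by move=> [Y FY Y1]; case: (FPi Y _ FY Y1) => _ _ /(_ Y1).
pose L := [set c * (1 - z) | c in [set: R]].
have PL : P L.
  right; split; first split.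
  - by exists 0; rewrite ?mul0r.
  - by move=> _ _ [c _ <-] [d _ <-]; exists (c + d); rewrite ?mulrDl.
  - by move=> a _ [c _ <-]; exists (a * c); rewrite // -mulrA.
  - by exists 1; rewrite ?mul1r.
  - by move=> [c _ c1]; apply: nc; exists c.
case: PM => [M0|[Mid M1z M1]].
  apply: (Mmax L) PL; rewrite M0; split=> // /(_ (1 - z)); apply.
  by exists 1; rewrite ?mul1r.
have Mm : maximal_left_ideal M.
  split=> // [MT|J Jid MJ]; first by apply: M1; rewrite MT.
  have [j1|J1] := pselect (J 1).
    right; apply/seteqP; split=> // x _; rewrite -[x]mulr1.
    by case: Jid => _ _; apply.
  left; apply/seteqP; split=> //; apply: contrapT => nJM.
  apply: (Mmax J) => //; right; split=> //; exact: MJ.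
case: (Mid) => _ MD _; apply: M1; rewrite -(subrK z 1); apply: MD => //.
exact: jz.
Qed.

Lemma ideal_actM (R : pzRingType) (I : ideal R) (M : lmodType R) a (x : M) :
  ideal_set I a -> submod_set (ideal_act I M) (a *: x).
Proof. by move=> Ia; apply: sub_gen_smallest; exists a => //; exists x. Qed.

(** Moves computations from [P] to [R], with [p0] in the role of [e]. Idempotence gives
    [a *: p0 = (a * e) *: p0], from which the converse implication follows. *)
Lemma left_ideal_iso_generator (R : pzRingType) (P : lmodType R) (e : R) :
  e * e = e -> left_ideal_iso P e ->
  exists p0 : P, (forall x, exists a, x = a *: p0) /\
    forall (I : ideal R) a,
      submod_set (ideal_act I P) (a *: p0) <-> ideal_set I (a * e).
Proof.
move=> ee [f [f_inj f_ran]].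
have [p0 fp0] : exists p0, f p0 = e.
  have : [set a * e | a in setT] e by exists e.
  by rewrite -f_ran => -[p0 _ <-]; exists p0.
have fZ a : f (a *: p0) = a * e by rewrite linearZ fp0.
have gen x : exists a, x = a *: p0.
  have : [set a * e | a in setT] (f x) by rewrite -f_ran; exists x.
  by case=> a _ ae; exists a; apply: f_inj; rewrite fZ ae.
exists p0; split=> // I a; split=> [|Iae].
  rewrite -fZ => Ia; apply: (Ia (fun x => ideal_set I (f x))); split.
    split=> [|x y Ix Iy|b x Ix]; rewrite ?linear0 ?linearD ?linearZ.
    - exact: ideal0.
    - exact: ideal_add.
    - exact: ideal_mull.
  move=> _ [b Ib [x _ <-]]; rewrite linearZ; exact: ideal_mulr.
have -> : a *: p0 = (a * e) *: p0.
  by apply: f_inj; rewrite !fZ -mulrA ee.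
exact: ideal_actM.
Qed.

Lemma submodule_cyclic (R : pzRingType) (M : lmodType R) (x : M) :
  submodule [set a *: x | a in [set: R]].
Proof.
split=> [|_ _ [a _ <-] [b _ <-]|a _ [b _ <-]].
- by exists 0; rewrite ?scale0r.
- by exists (a + b); rewrite ?scalerDl.
- by exists (a * b); rewrite ?scalerA.
Qed.

Lemma simple_cyclic (R : pzRingType) (M : lmodType R) (x y : M) :
  simple_module M -> x != 0 -> exists a, y = a *: x.
Proof.
move=> [_ /(_ _ (submodule_cyclic x)) [xM|xM]] x0.
  have : [set a *: x | a in [set: R]] x by exists 1; rewrite ?scale1r.
  by rewrite xM => /= x_eq0; rewrite x_eq0 eqxx in x0.
have : [set a *: x | a in [set: R]] y by rewrite xM.
by case=> a _ <-; exists a.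
Qed.

(* [M] is the top [R e / rad(R) e] of the left ideal [R e], with [s0] the
   class of [e]. *)
Definition top_generator (R : pzRingType) (M : lmodType R) (e : R) (s0 : M) :=
  (forall x, exists a, x = a *: s0) /\
  forall a, a *: s0 = 0 <-> ideal_set (jacobson R) (a * e).

Lemma top_generatorP (R : pzRingType) (P M : lmodType R) (e : R) :
  e * e = e -> left_ideal_iso P e ->
  mod_iso (quotmod (ideal_act (jacobson R) P)) M ->
  exists s0 : M, top_generator e s0.
Proof.
move=> ee /(left_ideal_iso_generator ee) [p0 [p0gen p0I]].
set Q := quotmod _ => -[g g_bij].
exists (g (\pi_Q p0)).
have gZ a : a *: g (\pi_Q p0) = g (\pi_Q (a *: p0)).
  by rewrite -linearZ; congr (g _); rewrite pi_quotmodZ.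
split=> [x|a]; last first.
  have piI : \pi_Q (a *: p0) = 0 <->
      submod_set (ideal_act (jacobson R) P) (a *: p0).
    rewrite -[a *: p0 in X in _ <-> X]subr0 -quotmod_eqP.
    suff -> : \pi_Q (0 : P) = 0 by [].
    exact: raddf0 \pi_{ideal_quot submod_pred _}.
  rewrite gZ -p0I -piI; split=> [|->]; last exact: linear0.
  by rewrite -[X in _ = X](linear0 g); apply: bij_inj.
case: g_bij => h gh hg; have [a ha] := p0gen (repr (h x)).
by exists a; rewrite gZ -ha reprK hg.
Qed.

Lemma top_generator_fix (R : pzRingType) (M : lmodType R) (e : R) (s0 : M) :
  e * e = e -> top_generator e s0 -> e *: s0 = s0.
Proof.
move=> ee [_ s0P]; apply/subr0_eq; rewrite -[X in _ - X]scale1r -scalerBl.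
by apply/s0P; rewrite mulrBl ee mul1r subrr; apply: ideal0.
Qed.

Lemma top_generator_neq0 (R : pzRingType) (M : lmodType R) (e : R) (s0 : M) :
  simple_module M -> top_generator e s0 -> s0 != 0.
Proof.
move=> [[x x0] _] [/(_ x) [a xa] _].
by apply: contraNneq x0 => s00; rewrite xa s00 scaler0.
Qed.

Lemma top_generator_notin (R : pzRingType) (M : lmodType R) (e : R) (s0 : M) :
  simple_module M -> e * e = e -> top_generator e s0 ->
  ~ ideal_set (jacobson R) e.
Proof.
move=> simM ee s0P; rewrite -[X in ideal_set _ X]ee => /(proj2 s0P).
rewrite (top_generator_fix ee s0P) => s00.
by have := top_generator_neq0 simM s0P; rewrite s00 eqxx.
Qed.

(** A nonzero [a *: s0] generates the simple module, so some [a'] takes it back to [s0]. For [a] in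
    [e R e] this makes [e R e] modulo the radical a division ring; an arbitrary [a] is allowed so
    that entries between different idempotents are covered too. *)
Lemma top_generator_inv (R : pzRingType) (M : lmodType R) (e : R) (s0 : M) :
  simple_module M -> top_generator e s0 ->
  forall a, ~ ideal_set (jacobson R) (a * e) ->
    exists a', ideal_set (jacobson R) (a' * a * e - e).
Proof.
move=> simM [_ s0P] a nae.
have as0 : a *: s0 != 0 by apply/eqP => /s0P.
have [a' s0a] := simple_cyclic s0 simM as0; exists a'.
rewrite -[X in _ - X]mul1r -mulrBl; apply/s0P.
by rewrite scalerBl scale1r -scalerA -s0a subrr.
Qed.

Lemma jacobson_top_generator (R : pzRingType) (M : lmodType R) (e : R) (s0 : M)
    a (x : M) :
  top_generator e s0 -> ideal_set (jacobson R) a -> a *: x = 0.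
Proof.
move=> [s0gen s0P] ra; have [b ->] := s0gen x; rewrite scalerA.
by apply/s0P/ideal_mulr/ideal_mulr.
Qed.

(* Gaussian elimination over the division ring [e R e / rad]: [h] row vectors
   of length [m < h] are linearly dependent. *)
Lemma elimination (R : pzRingType) (r : ideal R) (e : R) :
  e * e = e -> ~ ideal_set r e ->
  (forall a, ~ ideal_set r (a * e) -> exists a', ideal_set r (a' * a * e - e)) ->
  forall m h (Y : 'I_h -> 'I_m -> R), (m < h)%N ->
  exists c : 'I_h -> R,
    (exists l, ~ ideal_set r (c l * e)) /\
    forall q, ideal_set r (\sum_l c l * Y l q * e).
Proof.
move=> ee ne inv; elim=> [|m IH] [|h] Y //.
  move=> _; exists (fun=> e); split; last by case.
  by exists ord0; rewrite ee.
rewrite ltnS => mh.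
have [Y0|/existsNP [p Yp]] := pselect (forall l, ideal_set r (Y l ord0 * e)).
  have [|c [cn cY]] := IH h.+1 (fun l q => Y l (lift ord0 q)); first exact: ltnW.
  exists c; split=> // q; case: (unliftP ord0 q) => [q' ->|->]; first exact: cY.
  by apply: ideal_sum => l _; rewrite -mulrA; apply: ideal_mull.
have [y' y'Y] := inv _ Yp.
(* Row [p] is the pivot and [y'] inverts its first entry on [e]. Subtracting
   [Y (lift p l) ord0 * e * y'] times row [p] clears the first column modulo [r]; [cp] collects the
   multiples subtracted. *)
have [|c [[l cl] cY]] := IH h (fun l q => Y (lift p l) (lift ord0 q)
  - Y (lift p l) ord0 * e * y' * Y p (lift ord0 q)) => //.
pose cp := - \sum_l c l * Y (lift p l) ord0 * e * y'.
exists (fun l => if unlift p l is Some l' then c l' else cp); split.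
  by exists (lift p l); rewrite liftK.
move=> q; rewrite (bigD1_ord p) //= unlift_none.
rewrite (eq_bigr (fun l => c l * Y (lift p l) q * e)); last first.
  by move=> l' _; rewrite liftK.
rewrite /cp !mulNr !mulr_suml addrC -sumrB.
case: (unliftP ord0 q) => [q' ->|->].
  have := cY q'; congr (ideal_set r _); apply: eq_bigr => l' _.
  by rewrite mulrBr mulrBl !mulrA.
apply: ideal_sum => l' _; set x := c l' * _.
have -> : x * e - x * e * y' * Y p ord0 * e = x * e * (e - y' * Y p ord0 * e).
  by rewrite mulrBr !mulrA -[x * e * e]mulrA ee.
by apply: ideal_mull; apply: ideal_congr_sym.
Qed.

(** * Simple components, Schur's lemma and matrix units *)

Lemma sum_of_ideals_disjoint (Q : pzRingType) (s : nat) (C : 'I_s -> set Q)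
    (i j : 'I_s) (x : Q) :
  sum_of_ideals C -> i != j -> C i x -> C j x -> x = 0.
Proof.
move=> [Cid Csum] ij Cix Cjx.
pose d l : {ffun 'I_s -> Q} := [ffun l' => if l' == l then x else 0].
have dP l : C l x -> (forall l', C l' (d l l')) /\ x = \sum_l' d l l'.
  move=> Clx; split=> [l'|].
    by rewrite ffunE; case: eqP => [->|] //; case: (Cid l') => -[].
  rewrite (bigD1 l) //= ffunE eqxx big1 ?addr0 // => l' /negbTE l'l.
  by rewrite ffunE l'l.
have [c [_ cu]] := Csum x.
have := etrans (esym (cu _ (dP _ Cix))) (cu _ (dP _ Cjx)).
by move=> /ffunP/(_ i); rewrite !ffunE eqxx (negbTE ij).
Qed.

(** Schur's lemma: the kernel and the range of [f] are submodules of a simple module. *)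
Lemma endo_inv (k : fieldType) (A : algType k) (M : lmodType A) (f : endo M) :
  simple_module M -> f != 0 -> exists g : endo M, f * g = 1 /\ g * f = 1.
Proof.
move=> [_ simM] f0.
have kerP : submodule [set x | f x = 0].
  split=> [|x y /= fx fy|a x /= fx]; first exact: endo0.
    by rewrite endoD fx fy addr0.
  by rewrite endoZ fx scaler0.
have ker0 x : f x = 0 -> x = 0.
  have [k0|kT] := simM _ kerP => fx.
    have : [set x | f x = 0] x by [].
    by rewrite k0.
  case/eqP: f0; apply: endoP => y.
  by have : [set x | f x = 0] y by rewrite kT.
have ranP : submodule (range f).
  split=> [|_ _ [x _ <-] [y _ <-]|a _ [x _ <-]].
  - by exists 0 => //; apply: endo0.
  - by exists (x + y) => //; apply: endoD.
  - by exists (a *: x) => //; apply: endoZ.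
have f_onto y : exists x, f x = y.
  have [r0|rT] := simM _ ranP.
    case/eqP: f0; apply: endoP => x.
    by have : range f (f x) by [exists x]; rewrite r0.
  have : range f y by rewrite rT.
  by case=> x _ <-; exists x.
have [g fg] := choice f_onto.
have gf x : g (f x) = x.
  apply/subr0_eq/ker0; rewrite -[f _]/(f (g (f x) + - x)) endoD.
  have -> : f (- x) = - f x by rewrite -scaleN1r endoZ scaleN1r.
  by rewrite fg subrr.
have glin : linear g.
  move=> a x y; rewrite -[in LHS](fg x) -[in LHS](fg y).
  by rewrite -(endo_linear f) gf.
by exists (Endo glin); split; apply: endoP => x /=.
Qed.

(** Some [a] of the component moves [x = y *: s0] to a nonzero vector, and simplicity leads back to
    [s0]. Hence [e] is congruent modulo the radical to a multiple of [a]. *)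
Lemma idempotent_in_component (k : fieldType) (A : algType k) (M : lmodType A)
    (e : A) (s0 : M) (C : set (quotalg (jacobson A))) (CP : two_sided_ideal C) :
  simple_module M -> top_generator e s0 ->
  (exists (a : A) (x : M), C (\pi_(quotalg (jacobson A)) a) /\ a *: x != 0) ->
  ideal_set (preim_ideal CP) e.
Proof.
move=> simM s0P [a [x [Ca ax]]]; have [y xy] := (proj1 s0P) x.
have [|c cay] := top_generator_inv simM s0P (a := a * y).
  by move=> /(proj2 s0P); rewrite -scalerA -xy; apply/eqP.
apply: (ideal_congr_mem (ideal_congr_sym (preim_ideal_sub CP cay))).
rewrite mulrA; apply: (ideal_mulr ); apply: (ideal_mulr (I := preim_ideal CP)).
exact: (ideal_mull ).
Qed.

Definition elem_mx (D : pzRingType) (n : nat) (d : D) (a b : 'I_n) : 'M[D]_n :=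
  \matrix_(u, v) if (u == a) && (v == b) then d else 0.

Lemma elem_mxM (D : pzRingType) (n : nat) (x y : D) (a b c g : 'I_n) (M : 'M[D]_n) :
  elem_mx x a b * M * elem_mx y c g = elem_mx (x * M b c * y) a g.
Proof.
apply/matrixP => u v; rewrite !mxE (bigD1 c) //= big1 ?addr0; last first.
  by move=> l /negbTE lc; rewrite [in X in _ * X]mxE lc mulr0.
rewrite !mxE eqxx (bigD1 b) //= big1 ?addr0; last first.
  by move=> l /negbTE lb; rewrite mxE lb andbF mul0r.
by rewrite mxE eqxx andbT; case: eqP; case: eqP; rewrite ?mul0r ?mulr0.
Qed.

(* Writing [F] for the matrix of [e] and choosing [F a0 b0] invertible, the
   matrix [E] with the single entry [(F a0 b0)^-1] at [(b0, a0)] satisfies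
   [E F E = E]; simplicity of the top of [A e] then gives [F E F = F]. *)
Lemma matrix_units (k : fieldType) (A : algType k) (M : lmodType A) (n : nat)
    (e : A) (s0 : M) (C : set (quotalg (jacobson A))) (CP : two_sided_ideal C) :
  simple_module M -> e * e = e -> top_generator e s0 ->
  ideal_set (preim_ideal CP) e ->
  ideal_iso C (@matrix_scale k (endo M) n (fun c d => c *: d)) ->
  exists p q : 'I_n -> A,
    [/\ forall a, ideal_set (preim_ideal CP) (p a),
        forall a, ideal_set (preim_ideal CP) (q a),
        forall a b, ideal_set (jacobson A) (q a * p b - (if a == b then e else 0)),
        forall x, ideal_set (preim_ideal CP) x ->
          ideal_set (jacobson A) ((\sum_a p a * e * q a) * x - x)
      & forall x, ideal_set (preim_ideal CP) x ->
          ideal_set (jacobson A) (x * (\sum_a p a * e * q a) - x)].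
Proof.
move=> simM ee s0P Ce [f [fD fM _ f_inj f_ran]].
set Q := quotalg (jacobson A) in f fD fM f_inj f_ran *.
have piM := @pi_quotalg_mul _ _ (jacobson A).
have f0 : f 0 = 0 by apply: (addIr (f 0)); rewrite -fD !add0r.
have [F fF] : exists F, f F = \pi_Q e.
  have : C (\pi_Q e) by [].
  by rewrite -f_ran => -[F _ <-]; exists F.
have F0 : F != 0.
  apply/eqP => F0; apply: (top_generator_notin simM ee s0P).
  by apply/pi_quotalg_eq0; rewrite -[LHS]fF F0.
have FF : F * F = F by apply: f_inj; rewrite fM fF -piM ee.
have [a0 [b0 Fab]] : exists a b, F a b != 0.
  apply: contrapT => Fz; case/eqP: F0; apply/matrixP => a b; rewrite mxE.
  by apply/eqP; apply/negP => Fab; apply: Fz; exists a, b; apply/negP.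
have [d [Fd dF]] := endo_inv simM Fab.
have dFd : d * F a0 b0 * d = d by rewrite dF mul1r.
pose E : 'M[endo M]_n := elem_mx d b0 a0.
(* [X c * F * Y c] is the diagonal unit at [c], and [Y c * X c'] is [E] or [0]. So [X c * F] and
   [F * Y c], lifted to [p c] and [q c], act as the matrix units of a first column and a first row,
   with [F] in place of the corner unit. *)
pose X c : 'M[endo M]_n := elem_mx 1 c a0.
pose Y c : 'M[endo M]_n := elem_mx d b0 c.
have XFY c : X c * F * Y c = elem_mx 1 c c by rewrite elem_mxM mul1r Fd.
have YX c c' : Y c * X c' = if c == c' then E else 0.
  rewrite -[Y c]mulr1 elem_mxM mulr1 mxE; case: eqP => _; first by rewrite mulr1.
  by rewrite mulr0; apply/matrixP => u v; rewrite !mxE if_same.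
have EFE : E * F * E = E by rewrite elem_mxM dFd.
have E0 : E <> 0.
  move=> E0; have : E b0 a0 = 0 by rewrite E0 mxE.
  rewrite !mxE !eqxx /= => d0; move: Fab.
  by rewrite -[F a0 b0]mulr1 -Fd d0 !mulr0 eqxx.
have FEF : F * E * F = F.
  have [x fx] : exists x, \pi_Q x = f E by exists (repr (f E)); rewrite reprK.
  (* [F * E * F] is nonzero, since multiplying it by [E] on both sides gives [E]. Thus [F] is a left
     multiple of [F * E * F], which right multiplication by [E * F] fixes. *)
  have [|y yx] := top_generator_inv simM s0P (a := e * x).
    move=> /pi_quotalg_eq0; rewrite !piM -fF fx -!fM -f0 => /f_inj FEF0.
    have : E * (F * E * F) * E = E by rewrite !mulrA !EFE.
    by rewrite FEF0 mulr0 mul0r => /esym.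
  have /quotalg_eqP := yx; rewrite !piM -fF fx => yF.
  have {}yF : \pi_Q y * f (F * E * F) = f F by rewrite !fM -[RHS]yF !mulrA.
  have FEFE : F * E * F * E = F * E by rewrite -!mulrA [E * (F * E)]mulrA EFE.
  apply: f_inj; transitivity (\pi_Q y * f (F * E * F) * f E * f F).
    by rewrite yF -!fM.
  by rewrite -!mulrA -!fM !mulrA FEFE.
have [p fp] : exists p : 'I_n -> A, forall c, \pi_Q (p c) = f (X c * F).
  by exists (fun c => repr (f (X c * F))) => c; rewrite reprK.
have [q fq] : exists q : 'I_n -> A, forall c, \pi_Q (q c) = f (F * Y c).
  by exists (fun c => repr (f (F * Y c))) => c; rewrite reprK.
have pq1 : \pi_Q (\sum_c p c * e * q c) = f 1.
  rewrite pi_quotalg_sum; under eq_bigr do rewrite !piM fp fq -fF -!fM.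
  rewrite -(big_morph f fD f0); congr (f _); apply/matrixP => u v.
  rewrite summxE (bigD1 u) //= big1 ?addr0 => [|l lu].
    by rewrite mulrA -(mulrA (X u)) FF -(mulrA (X u)) FF XFY
      !mxE eqxx eq_sym; case: eqP.
  by rewrite mulrA -(mulrA (X l)) FF -(mulrA (X l)) FF XFY !mxE eq_sym (negbTE lu).
exists p, q; split=> [c|c|c c'|x Cx|x Cx].
- by rewrite /= -/Q fp -f_ran; exists (X c * F).
- by rewrite /= -/Q fq -f_ran; exists (F * Y c).
- apply/quotalg_eqP; rewrite -/Q piM fp fq -fM mulrA -[F * _ * _]mulrA YX.
  by case: eqP => _; rewrite ?FEF ?fF // mulr0 mul0r f0 pi_quotalg0.
- apply/quotalg_eqP; rewrite -/Q piM pq1.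
  have : C (\pi_Q x) by [].
  by rewrite -f_ran => -[Z _ <-]; rewrite -fM mul1r.
- apply/quotalg_eqP; rewrite -/Q piM pq1.
  have : C (\pi_Q x) by [].
  by rewrite -f_ran => -[Z _ <-]; rewrite -fM mulr1.
Qed.

(** * Generators of the arrow bimodules and ideals above the squared radical *)

Lemma generated_by_lift (k : fieldType) (A : algType k)
    (CL CR : set (quotalg (jacobson A)))
    (CLP : two_sided_ideal CL) (CRP : two_sided_ideal CR) (u u' : A) (t : nat) :
  (forall x, ideal_set (preim_ideal CLP) x -> ideal_set (jacobson A) (u * x - x)) ->
  (forall x, ideal_set (preim_ideal CRP) x -> ideal_set (jacobson A) (x * u' - x)) ->
  generated_by CL CR (arrow_bimodule CL CR) t ->
  exists w : 'I_t -> A,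
    [/\ forall l, ideal_set (jacobson A) (w l),
        forall l, ideal_set (ideal_square (jacobson A)) (w l - u * w l * u')
      & forall a x b, ideal_set (preim_ideal CLP) a -> ideal_set (jacobson A) x ->
          ideal_set (preim_ideal CRP) b ->
          ideal_set (square_ext (jacobson A) w) (a * x * b)].
Proof.
set r := jacobson A; set r2 := ideal_square r; set W := arrow_bimodule CL CR.
set Q2 := quotalg r2 => uP u'P [w' [w'W WE]].
have lift z : W z -> exists y,
    [/\ ideal_set r y, ideal_set r2 (y - u * y * u') & z = \pi_Q2 y].
  move: z; apply: smallest_sub.
    split=> [|_ _ [x [rx xu ->]] [y [ry yu ->]]|_ [x [rx xu ->]]].
    - exists 0; rewrite mulr0 mul0r subrr.
      by split; [exact: ideal0|exact: ideal0|rewrite pi_quotalg0].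
    - exists (x + y); split; [exact: ideal_add| |by rewrite pi_quotalgD].
      by rewrite mulrDr mulrDl opprD addrACA; apply: ideal_add.
    - exists (- x); split; [exact: ideal_opp| |by rewrite pi_quotalg_opp].
      by rewrite mulrN mulNr -opprD; apply: ideal_opp.
  move=> _ [a [x [b [Ca rx Cb ->]]]]; exists (a * x * b); split=> //.
    by apply: ideal_mulr; apply: ideal_mull.
  have -> : u * (a * x * b) * u' = (u * a) * x * (b * u') by rewrite !mulrA.
  apply: square_congrMr; [by apply: ideal_congr_sym; apply: u'P|exact: ideal_mull|].
  apply: square_congrM => //; first by apply: ideal_congr_sym; apply: uP.
  by rewrite subrr; apply: ideal0.
have /choice [w wP] : forall l, exists y,
    [/\ ideal_set r y, ideal_set r2 (y - u * y * u') & w' l = \pi_Q2 y].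
  by move=> l; apply: lift; apply: w'W; exists l.
exists w; split=> [l|l|a x b Ca rx Cb]; try by case: (wP l).
have : W (\pi_Q2 (a * x * b)) by apply: sub_gen_smallest; exists a, x, b.
(* [W] is the least sub-bimodule containing the generators, so it is enough that the classes of
   elements of [r] lying in [square_ext r w] form a sub-bimodule. *)
rewrite WE => /(_ [set z | exists y, [/\ ideal_set r y,
  ideal_set (square_ext r w) y & z = \pi_Q2 y]]) [].
  split; first split.
  - by move=> _ [y [ry _ ->]]; exists y.
  - split=> [|_ _ [y [ry wy ->]] [z [rz wz ->]]|_ [y [ry wy ->]]].
    + by exists 0; split; [exact: ideal0|exact: ideal0|rewrite pi_quotalg0].
    + exists (y + z); split; [exact: ideal_add|exact: ideal_add|].
      by rewrite pi_quotalgD.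
    + exists (- y); split; [exact: ideal_opp|exact: ideal_opp|].
      by rewrite pi_quotalg_opp.
  - move=> c _ _ [y [ry wy ->]]; exists (c * y).
    by split; [exact: ideal_mull|exact: ideal_mull|rewrite pi_quotalg_mul].
  - move=> c _ _ [y [ry wy ->]]; exists (y * c).
    by split; [exact: ideal_mulr|exact: ideal_mulr|rewrite pi_quotalg_mul].
  move=> _ [l _ <-]; exists (w l); case: (wP l) => rw _ ->; split=> //.
  exact: square_ext_gen.
by move=> y [ry wy /quotalg_eqP xy]; apply: square_ext_congr xy wy.
Qed.

Lemma generated_byI (k : fieldType) (A : algType k)
    (CL CR : set (quotalg (jacobson A)))
    (CLP : two_sided_ideal CL) (CRP : two_sided_ideal CR) (u u' : A)
    (t : nat) (w : 'I_t -> A) :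
  ideal_set (preim_ideal CLP) u -> ideal_set (preim_ideal CRP) u' ->
  (forall x, ideal_set (preim_ideal CLP) x -> ideal_set (jacobson A) (u * x - x)) ->
  (forall x, ideal_set (preim_ideal CRP) x -> ideal_set (jacobson A) (x * u' - x)) ->
  (forall l, ideal_set (jacobson A) (w l)) ->
  (forall l, arrow_bimodule CL CR
     (\pi_(quotalg (ideal_square (jacobson A))) (w l))) ->
  (forall a x b, ideal_set (preim_ideal CLP) a -> ideal_set (jacobson A) x ->
     ideal_set (preim_ideal CRP) b ->
     ideal_set (square_ext (jacobson A) w) (a * x * b)) ->
  generated_by CL CR (arrow_bimodule CL CR) t.
Proof.
set r := jacobson A; set r2 := ideal_square r; set W := arrow_bimodule CL CR.
set Q2 := quotalg r2 => Cu Cu' uP u'P rw Ww wgen.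
have Wsub : additive_subgroup W.
  split=> [J [[]] //|x y Wx Wy J JP|x Wx J JP].
    by case: (JP) => -[_ JD _] _; apply: JD; [apply: Wx|apply: Wy].
  by case: (JP) => -[_ _ JN] _; apply: JN; apply: Wx.
have W_r : W `<=` \pi_Q2 @` ideal_set r.
  apply: smallest_sub.
    split=> [|_ _ [x rx <-] [y ry <-]|_ [x rx <-]].
    - by exists 0; [exact: ideal0|rewrite pi_quotalg0].
    - by exists (x + y); [exact: ideal_add|rewrite pi_quotalgD].
    - by exists (- x); [exact: ideal_opp|rewrite pi_quotalg_opp].
  move=> _ [a [x [b [_ rx _ ->]]]]; exists (a * x * b) => //.
  by apply: ideal_mulr; apply: ideal_mull.
have W_bim : sub_bimodule CL CR W.
  split=> //.
    move=> c z Cc; move: z.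
    apply: (smallest_sub (X := [set z | W (\pi_Q2 c * z)])).
      case: Wsub => W0 WD WN; split=> [|x y Wx Wy|x Wx] /=.
      - by rewrite mulr0.
      - by rewrite mulrDr; apply: WD.
      - by rewrite mulrN; apply: WN.
    move=> _ [a [x [b [Ca rx Cb ->]]]] /=; rewrite -pi_quotalg_mul.
    apply: sub_gen_smallest; exists (c * a), x, b; split; rewrite ?mulrA //.
    exact: (ideal_mull (I := preim_ideal CLP)).
  move=> c z Cc; move: z.
  apply: (smallest_sub (X := [set z | W (z * \pi_Q2 c)])).
    case: Wsub => W0 WD WN; split=> [|x y Wx Wy|x Wx] /=.
    - by rewrite mul0r.
    - by rewrite mulrDl; apply: WD.
    - by rewrite mulNr; apply: WN.
  move=> _ [a [x [b [Ca rx Cb ->]]]] /=; rewrite -pi_quotalg_mul.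
  apply: sub_gen_smallest; exists a, x, (b * c); split; rewrite ?mulrA //.
  exact: (ideal_mulr (I := preim_ideal CRP)).
exists (fun l => \pi_Q2 (w l)); split=> [_ [l _ <-]|]; first exact: Ww.
apply/seteqP; split; last by apply: smallest_sub => // _ [l _ <-]; exact: Ww.
move=> z Wz V [[Vr [V0 VD VN] VL VR] wV].
(* [V] is stable only under [CL] and [CR], so its preimage need not be an ideal. The elements of [r]
   sent into [V] by all multipliers [a] of [CL] and [b] of [CR] do form one, and the choice [a = u],
   [b = u'] leads back to [V]. *)
have VLR : two_sided_ideal [set y | ideal_set r y /\
    forall a b, ideal_set (preim_ideal CLP) a -> ideal_set (preim_ideal CRP) b ->
      V (\pi_Q2 (a * y * b))].
  split; first split=> [|x y [rx Vx] [ry Vy]|x [rx Vx]] /=.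
  - split=> [|a b _ _]; first exact: (ideal0 r).
    by rewrite mulr0 mul0r pi_quotalg0.
  - split=> [|a b Ca Cb]; first exact: (ideal_add (I := r)).
    by rewrite mulrDr mulrDl pi_quotalgD; apply: VD; [exact: Vx|exact: Vy].
  - split=> [|a b Ca Cb]; first exact: (ideal_opp (I := r)).
    by rewrite mulrN mulNr pi_quotalg_opp; apply: VN; exact: Vx.
  - move=> c x [rx Vx]; split=> [|a b Ca Cb]; first exact: (ideal_mull (I := r)).
    by rewrite mulrA; apply: Vx => //; apply: (ideal_mulr (I := preim_ideal CLP)).
  - move=> c x [rx Vx]; split=> [|a b Ca Cb]; first exact: (ideal_mulr (I := r)).
    rewrite mulrA -mulrA; apply: Vx => //.
    exact: (ideal_mull (I := preim_ideal CRP)).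
have wVLR : ideal_set (square_ext r w) `<=` ideal_set (Ideal VLR).
  apply: square_ext_min => [x r2x|l] /=.
    split=> [|a b _ _]; first exact: (ideal_square_sub (I := r)).
    have /pi_quotalg_eq0 -> // : ideal_set r2 (a * x * b).
    by apply: ideal_mulr; apply: ideal_mull.
  split=> [|a b Ca Cb]; first exact: rw.
  rewrite !pi_quotalg_mul.
  by apply: VR => //; apply: VL => //; apply: wV; exists l.
move: z Wz; apply: smallest_sub => // _ [a [x [b [Ca rx Cb ->]]]].
have /wVLR [_ /(_ u u' Cu Cu')] := wgen a x b Ca rx Cb.
congr (V _); apply/quotalg_eqP.
have -> : u * (a * x * b) * u' = (u * a) * x * (b * u') by rewrite !mulrA.
apply: square_congrMr; [exact: u'P|by apply: ideal_mull|].
apply: square_congrM => //; first exact: uP.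
by rewrite subrr; apply: ideal0.
Qed.

(** Inserting the identities of the two components next to [x] splits [a * x * b], modulo [r^2],
    into multiples of elements of [e r e']. *)
Lemma component_cover (R : pzRingType) (r I CL CR : ideal R) (nL nR : nat)
    (e e' : R) (p q : 'I_nL -> R) (p' q' : 'I_nR -> R) :
  ideal_set (ideal_square r) `<=` ideal_set I ->
  (forall x, ideal_set CL x -> ideal_set r (x * (\sum_a p a * e * q a) - x)) ->
  (forall x, ideal_set CR x -> ideal_set r ((\sum_b p' b * e' * q' b) * x - x)) ->
  (forall x, ideal_set r x -> ideal_set I (e * x * e')) ->
  forall a x b, ideal_set CL a -> ideal_set r x -> ideal_set CR b ->
    ideal_set I (a * x * b).
Proof.
move=> rI CLid CRid Ie a x b Ca rx Cb; set u := \sum_a _ in CLid.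
set u' := \sum_b _ in CRid.
apply: (@ideal_congr_mem _ _ ((a * u) * x * (u' * b))).
  apply: rI; apply: ideal_congr_sym; apply: square_congrMr; first exact: CRid.
    exact: ideal_mull.
  apply: square_congrM => //; first exact: CLid.
  by rewrite subrr; apply: ideal0.
rewrite -!mulrA; apply: ideal_mull; rewrite !mulrA; apply: ideal_mulr.
rewrite /u /u' !mulr_suml; apply: ideal_sum => i _.
rewrite mulr_sumr; apply: ideal_sum => l _.
rewrite -!mulrA; apply: ideal_mull; rewrite !mulrA; apply: ideal_mulr.
have -> : e * q i * x * p' l * e' = e * (q i * x * p' l) * e' by rewrite !mulrA.
by apply: Ie; apply: ideal_mulr; apply: ideal_mull.
Qed.

Lemma arrow_bimoduleM (k : fieldType) (A : algType k)
    (CL CR : set (quotalg (jacobson A)))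
    (CLP : two_sided_ideal CL) (CRP : two_sided_ideal CR) (T : Type) (l : seq T)
    (a x b : T -> A) :
  (forall i, ideal_set (preim_ideal CLP) (a i)) ->
  (forall i, ideal_set (jacobson A) (x i)) ->
  (forall i, ideal_set (preim_ideal CRP) (b i)) ->
  arrow_bimodule CL CR
    (\pi_(quotalg (ideal_square (jacobson A))) (\sum_(i <- l) a i * x i * b i)).
Proof.
move=> Ca rx Cb J [[J0 JD _] JW]; rewrite pi_quotalg_sum; elim/big_ind: _ => // i _.
by apply: JW; exists (a i), (x i), (b i); split=> //; [exact: Ca|exact: Cb].
Qed.

(* Several generators of the corner [e (r / r^2) e'] are packed as the entries
   of one matrix over it. *)
Lemma pack_generators (k : fieldType) (A : algType k)
    (CL CR : set (quotalg (jacobson A)))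
    (CLP : two_sided_ideal CL) (CRP : two_sided_ideal CR) (nL nR : nat)
    (e e' : A) (p q : 'I_nL -> A) (p' q' : 'I_nR -> A) (t m : nat) (v : 'I_m -> A) :
  (forall a, ideal_set (preim_ideal CLP) (p a)) ->
  (forall b, ideal_set (preim_ideal CRP) (q' b)) ->
  (forall a b, ideal_set (jacobson A) (q a * p b - (if a == b then e else 0))) ->
  (forall a b, ideal_set (jacobson A) (q' a * p' b - (if a == b then e' else 0))) ->
  (forall l, ideal_set (jacobson A) (v l)) ->
  (forall l, e * v l * e' = v l) ->
  (m <= t * (nL * nR))%N ->
  exists w : 'I_t -> A,
    [/\ forall l, ideal_set (jacobson A) (w l),
        forall l, arrow_bimodule CL CR
          (\pi_(quotalg (ideal_square (jacobson A))) (w l))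
      & forall l, ideal_set (square_ext (jacobson A) w) (v l)].
Proof.
set r := jacobson A => Cp Cq' qp q'p' rv eve mt.
have mT : (m <= #|{: 'I_t * ('I_nL * 'I_nR)}|)%N by rewrite !card_prod !card_ord.
pose g (l : 'I_m) : 'I_t * ('I_nL * 'I_nR) := enum_val (widen_ord mT l).
have g_inj : injective g.
  by move=> l l' /enum_val_inj /(congr1 val) /= ll'; apply: val_inj.
(* Matrix positions that receive no generator are filled with [0]. *)
pose v' x := if [pick l | g l == x] is Some l then v l else 0.
have v'g l : v' (g l) = v l.
  rewrite /v'; case: pickP => [l' /eqP/g_inj -> //|/(_ l)]; by rewrite eqxx.
have rv' x : ideal_set r (v' x).
  by rewrite /v'; case: pickP => [l _|_]; [exact: rv|exact: ideal0].
have ev' x : e * v' x * e' = v' x.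
  by rewrite /v'; case: pickP => [l _|_]; [exact: eve|rewrite mulr0 mul0r].
pose w t' := \sum_(ab : 'I_nL * 'I_nR) p ab.1 * v' (t', ab) * q' ab.2.
exists w; split=> [t'|t'|l].
- by apply: ideal_sum => ab _; apply: ideal_mulr; apply: ideal_mull.
- by apply: arrow_bimoduleM => ab; [exact: Cp|exact: rv'|exact: Cq'].
rewrite -v'g; case: (g l) => t' [a b].
(* Multiplication by [q a] and [p' b] reads off the entry at [(a, b)]: all other terms vanish modulo
   the squared radical. *)
apply: (@square_ext_congr _ _ _ _ _ (q a * w t' * p' b)); last first.
  by apply: ideal_mulr; apply: ideal_mull; apply: square_ext_gen.
apply: ideal_congr_sym; rewrite /w mulr_sumr mulr_suml.
have -> : v' (t', (a, b)) = \sum_(ab : 'I_nL * 'I_nR)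
    (if a == ab.1 then e else 0) * v' (t', ab) * (if ab.2 == b then e' else 0).
  rewrite (bigD1 (a, b)) //= !eqxx ev' big1 ?addr0 // => -[a' b'] /=.
  rewrite xpair_eqE [a == _]eq_sym; case: eqP => _; case: eqP => _ //= _.
  - by rewrite mulr0.
  - by rewrite !mul0r.
  - by rewrite !mul0r.
apply: ideal_congr_sum => x _.
have -> : q a * (p x.1 * v' (t', x) * q' x.2) * p' b
  = (q a * p x.1) * v' (t', x) * (q' x.2 * p' b) by rewrite !mulrA.
apply: square_congrMr; [exact: q'p'|by apply: ideal_mull|].
by apply: square_congrM; [exact: qp|exact: rv'|rewrite subrr; exact: ideal0].
Qed.

(** The expansion of the two identities writes [w l] as a sum of its entries, each between some
    [p a] and some [q' b]. *)
Lemma unpack_generators (R : pzRingType) (r : ideal R) (nL nR : nat)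
    (e e' : R) (p q : 'I_nL -> R) (p' q' : 'I_nR -> R) (T : Type) (w : T -> R) :
  (forall l, ideal_set (ideal_square r)
     (w l - (\sum_a p a * e * q a) * w l * (\sum_b p' b * e' * q' b))) ->
  ideal_set (square_ext r w) `<=`
  ideal_set (square_ext r
    (fun x : T * ('I_nL * 'I_nR) => e * (q x.2.1 * w x.1 * p' x.2.2) * e')).
Proof.
set v := fun x : T * _ => _; move=> wu.
apply: square_ext_min => [|l]; first exact: square_ext_sq.
apply: (square_ext_congr (wu l)); rewrite !mulr_suml; apply: ideal_sum => a _.
rewrite mulr_sumr; apply: ideal_sum => b _.
have -> : p a * e * q a * w l * (p' b * e' * q' b) =
    p a * (e * (q a * w l * p' b) * e') * q' b by rewrite !mulrA.
apply: ideal_mulr; apply: ideal_mull; exact: (@square_ext_gen _ r _ v (l, (a, b))).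
Qed.

(** * The diagram as a dimension over a division ring *)

Lemma diagram_basis (R : pzRingType) (s : nat) (S : 'I_s -> lmodType R)
    (P : lmodType R) (h : 'I_s -> nat) (e e' : R) (j : 'I_s) (s0 : S j) :
  e * e = e -> top_generator e s0 ->
  (forall j', j' != j -> forall z : S j', e *: z = 0) ->
  e' * e' = e' -> left_ideal_iso P e' ->
  (let Q := quotmod (ideal_act (ideal_square (jacobson R)) P) in
    iso_sum_of_simples S (\pi_Q @` ideal_act (jacobson R) P) h) ->
  exists U : 'I_(h j) -> R,
    [/\ forall l, ideal_set (jacobson R) (U l),
        forall l, e * U l * e' = U l,
        forall x, ideal_set (jacobson R) x -> exists a : 'I_(h j) -> R,
          ideal_set (ideal_square (jacobson R)) (e * x * e' - \sum_l a l * U l)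
      & forall c : 'I_(h j) -> R,
          ideal_set (ideal_square (jacobson R)) (\sum_l c l * U l) ->
          forall l, ideal_set (jacobson R) (c l * e)].
Proof.
move=> ee s0P ekill e'e' /(left_ideal_iso_generator e'e') [p0 [p0gen p0I]].
set r := jacobson R; set r2 := ideal_square r; set Q := quotmod _ => -[u].
set f := (fun x : forall j, 'I_(h j) -> S j => _) => -[f_inj f_ran].
have pi0 : \pi_Q (0 : P) = 0 by exact: raddf0 \pi_{ideal_quot submod_pred _}.
have piZ a (x : P) : \pi_Q (a *: x) = a *: \pi_Q x by exact: pi_quotmodZ.
have piE a b : \pi_Q (a *: p0) = \pi_Q (b *: p0) <-> ideal_set r2 ((a - b) * e').
  by rewrite quotmod_eqP -scalerBl p0I.
have pi_sum (T : Type) (l : seq T) (a : T -> R) :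
    \pi_Q ((\sum_(x <- l) a x) *: p0) = \sum_(x <- l) \pi_Q (a x *: p0).
  rewrite scaler_suml.
  exact: (big_morph _ (@pi_quotmodD _ _ (ideal_act r2 P)) pi0).
pose d (z : 'I_(h j) -> S j) := dfwith (fun j' (_ : 'I_(h j')) => 0 : S j') z.
have fd z : f (d z) = \sum_l u j l (z l).
  rewrite /f (bigD1 j) //= [X in _ + X]big1 ?addr0 => [|j' j'j].
    by rewrite /d dfwith_in.
  by apply: big1 => l _; rewrite /d dfwith_out 1?eq_sym // linear0.
have lift l : exists b, ideal_set r (b * e') /\ \pi_Q (b *: p0) = u j l s0.
  have : range f (u j l s0).
    exists (d (fun l' => if l' == l then s0 else 0)) => //.
    rewrite fd (bigD1 l) //= eqxx big1 ?addr0 // => l' /negbTE ->.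
    by rewrite linear0.
  rewrite f_ran => -[y ry yu]; have [b yb] := p0gen y.
  by exists b; rewrite -yb; split=> //; apply/p0I; rewrite -yb.
have [b bP] := choice lift.
(* [b l] represents [s0] in the [l]-th copy of [S j]. Neither new factor changes the class: [e]
   fixes [s0], and [p0] absorbs [e']. *)
pose U l := e * b l * e'.
have piU l : \pi_Q (U l *: p0) = u j l s0.
  have -> : \pi_Q (U l *: p0) = \pi_Q ((e * b l) *: p0).
    by apply/piE; rewrite mulrBl /U -!mulrA e'e' subrr; apply: ideal0.
  by rewrite -scalerA piZ (proj2 (bP l)) -linearZ /= (top_generator_fix ee s0P).
have piaU (a : 'I_(h j) -> R) :
    \pi_Q ((\sum_l a l * U l) *: p0) = \sum_l u j l (a l *: s0).
  by rewrite pi_sum; apply: eq_bigr => l _; rewrite -scalerA piZ piU linearZ.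
have Ue l : U l * e' = U l by rewrite /U -mulrA e'e'.
exists U; split=> [l|l|x rx|c cU l].
- by rewrite /U -mulrA; apply: ideal_mull; exact: (proj1 (bP l)).
- by rewrite -mulrA Ue /U !mulrA ee.
- have : range f (\pi_Q (x *: p0)).
    rewrite f_ran; exists (x *: p0) => //; apply/p0I; exact: ideal_mulr.
  case=> z _ fz.
  have [a az] := choice (fun l => (proj1 s0P) (z j l)).
  (* Multiplication by [e] removes the copies of the other simple modules by [ekill]; only the
     coordinates [z j l = a l *: s0] remain. *)
  exists (fun l => e * a l).
  have : \pi_Q ((e * x) *: p0) = \pi_Q ((\sum_l e * a l * U l) *: p0).
    rewrite piaU -scalerA piZ -fz /f scaler_sumr (bigD1 j) //=.
    rewrite [X in _ + X]big1 ?addr0.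
      by rewrite scaler_sumr; apply: eq_bigr => l _; rewrite -linearZ /= az scalerA.
    move=> j' j'j; rewrite scaler_sumr; apply: big1 => l _.
    by rewrite -linearZ /= ekill // linear0.
  move=> /piE; rewrite mulrBl mulr_suml.
  by under eq_bigr do rewrite -[_ * e']mulrA Ue.
have : f (d (fun l => c l *: s0)) = f (d (fun=> 0)).
  rewrite !fd -piaU [RHS]big1 => [|l' _]; last exact: linear0.
  rewrite -[RHS]pi0 -(scale0r p0); apply/piE; rewrite subr0; exact: ideal_mulr.
move=> /f_inj /(congr1 (fun z : forall j, 'I_(h j) -> S j => z j l)).
by rewrite /d !dfwith_in => /(proj2 s0P).
Qed.

(** Modulo the radical, [e' * y * e'] is a combination of the [b q] with central coefficients, which
    can be moved to the left of [V x]. So the products [V x * b q] span from the left, and more than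
    [#|K| * d] elements [U l] would be dependent. *)
Lemma diagram_bound (R : pzRingType) (h d : nat) (K : finType)
    (e e' : R) (U : 'I_h -> R) (V : K -> R) (b : 'I_d -> R) :
  e * e = e -> e' * e' = e' -> ~ ideal_set (jacobson R) e ->
  (forall a, ~ ideal_set (jacobson R) (a * e) ->
     exists a', ideal_set (jacobson R) (a' * a * e - e)) ->
  (forall l, ideal_set (jacobson R) (U l)) ->
  (forall l, e * U l * e' = U l) ->
  (forall c : 'I_h -> R,
     ideal_set (ideal_square (jacobson R)) (\sum_l c l * U l) ->
     forall l, ideal_set (jacobson R) (c l * e)) ->
  (forall x, ideal_set (jacobson R) (V x)) ->
  (forall x, e * V x * e' = V x) ->
  (forall x, ideal_set (jacobson R) x ->
     ideal_set (square_ext (jacobson R) V) (e * x * e')) ->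
  (forall y, exists2 c : 'I_d -> R, forall q x, c q * x = x * c q &
     ideal_set (jacobson R) (e' * y * e' - \sum_q c q * b q)) ->
  (h <= #|K| * d)%N.
Proof.
set r := jacobson R; set r2 := ideal_square r.
move=> ee e'e' ne inv rU eU Ufree rV eV Vgen bspan.
pose comb (Y : K * 'I_d -> R) := \sum_x Y x * (V x.1 * b x.2).
(* The multipliers [a] and [c] make [Z] a two-sided ideal, so that it can be compared with
   [square_ext r V]; only [a = c = 1] is used afterwards. *)
pose Z : set R := [set y | forall a c, exists Y,
  ideal_set r2 (e * a * y * c * e' - comb Y)].
have combD Y Y' : comb Y + comb Y' = comb (fun x => Y x + Y' x).
  by rewrite -big_split; apply: eq_bigr => x _; rewrite mulrDl.
have combN Y : - comb Y = comb (fun x => - Y x).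
  by rewrite -sumrN; apply: eq_bigr => x _; rewrite mulNr.
have comb0 : comb (fun=> 0) = 0 by apply: big1 => x _; rewrite mul0r.
have ZP : two_sided_ideal Z.
  split; first split=> [a c|x y Zx Zy a c|x Zx a c].
  - exists (fun=> 0); rewrite comb0 mulr0 !mul0r subrr; exact: ideal0.
  - have [Y xY] := Zx a c; have [Y' yY'] := Zy a c.
    exists (fun x => Y x + Y' x); rewrite -combD mulrDr !mulrDl opprD addrACA.
    exact: ideal_add.
  - have [Y xY] := Zx a c; exists (fun x => - Y x).
    by rewrite -combN mulrN !mulNr -opprD; apply: ideal_opp.
  - move=> a' x Zx a c; have [Y xY] := Zx (a * a') c.
    by exists Y; rewrite !mulrA in xY *.
  - move=> a' x Zx a c; have [Y xY] := Zx a (a' * c).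
    by exists Y; rewrite !mulrA in xY *.
have VZ : ideal_set (square_ext r V) `<=` ideal_set (Ideal ZP).
  apply: square_ext_min => [y r2y a c|x a c].
    exists (fun=> 0); rewrite comb0 subr0.
    by do 2 apply: ideal_mulr; apply: ideal_mull.
  have [g gC gP] := bspan c.
  exists (fun z => if z.1 == x then g z.2 * (e * a) else 0).
  have -> : comb (fun z => if z.1 == x then g z.2 * (e * a) else 0) =
      (e * a) * (V x * \sum_q g q * b q).
    rewrite /comb -(pair_bigA _ (fun x' q =>
      (if x' == x then g q * (e * a) else 0) * (V x' * b q))) /=.
    rewrite (bigD1 x) //= eqxx.
    rewrite [X in _ + X]big1 ?addr0 => [|x' /negbTE ->]; last first.
      by apply: big1 => q _; rewrite mul0r.
    rewrite !mulr_sumr; apply: eq_bigr => q _.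
    by rewrite gC -!mulrA [V x * (g q * _)]mulrA -gC -mulrA.
  have -> : e * a * V x * c * e' = (e * a) * (V x * (e' * c * e')).
    have Ve : V x * e' = V x by rewrite -(eV x) -mulrA e'e'.
    by rewrite -!mulrA [V x * (e' * _)]mulrA Ve.
  by rewrite -!mulrBr; apply: ideal_mull; apply: ideal_squareM.
rewrite leqNgt; apply/negP => Kh.
have /choice [Y YP] : forall l, exists Y, ideal_set r2 (U l - comb Y).
  move=> l; have /VZ /(_ 1 1) [Y] := Vgen _ (rU l).
  by rewrite eU !mulr1 eU => UY; exists Y.
have Kh' : (#|{: K * 'I_d}| < h)%N by rewrite card_prod card_ord.
have [c [[l cl] cY]] := elimination ee ne inv (fun l q => Y l (enum_val q)) Kh'.
apply: cl; apply: Ufree; apply: (@ideal_congr_mem _ _ (\sum_l c l * comb (Y l))).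
  by apply: ideal_congr_sum => l' _; rewrite -mulrBr; apply: ideal_mull.
rewrite (eq_bigr (fun l => \sum_x c l * Y l x * (V x.1 * b x.2))); last first.
  by move=> l' _; rewrite mulr_sumr; apply: eq_bigr => x _; rewrite [LHS]mulrA.
rewrite exchange_big; apply: ideal_sum => x _ /=.
(* Elimination controls the coefficients only after right multiplication by [e], which [V x]
   supplies because [e] fixes it on the left. *)
have -> : \sum_l c l * Y l x * (V x.1 * b x.2)
    = (\sum_l c l * Y l x * e) * (V x.1 * b x.2).
  rewrite mulr_suml; apply: eq_bigr => l' _.
  rewrite -[in LHS](eV x.1) -[in RHS](eV x.1).
  by rewrite !mulrA -[_ * e * e]mulrA ee.
have := cY (enum_rank x); rewrite enum_rankK => cYx.
by apply: (ideal_squareM (I := r)) => //; apply: (ideal_mulr (I := r)).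
Qed.

(** * The radical of the basic algebra *)

Lemma corner_jacobson_sup (k : fieldType) (A : algType k) (u : idempotent_elt A)
    (x : corner u) :
  ideal_set (jacobson A) (val x) -> ideal_set (jacobson (corner u)) x.
Proof.
move=> rx I [[I0 ID IZ] IT Imax]; apply: contrapT => nIx.
(* [J] is [I] plus the left multiples of [x]. If it is everything, then [1 - b * x] lies in [I] for
   some [b]; a left inverse of it in [A], compressed to the corner, is still a left inverse, so [I]
   would be improper. *)
pose J : set (corner u) := [set y | exists2 b, I (y - b * x) & True].
have JP : left_ideal J.
  split=> [|y z [b Ib _] [c Ic _]|a y [b Ib _]].
  - by exists 0 => //; rewrite mul0r subr0.
  - by exists (b + c) => //; rewrite mulrDl opprD addrACA; apply: ID.
  - exists (a * b) => //; rewrite -[a *: y]/(a * y) -mulrA -mulrBr.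
    exact: (IZ a _ Ib).
have IJ : I `<=` J by move=> y Iy; exists 0 => //; rewrite mul0r subr0.
case: (Imax J JP IJ) => [JI|JT].
  by apply: nIx; rewrite -JI; exists 1 => //; rewrite mul1r subrr.
have [b Ib _] : J 1 by rewrite JT.
have [c c1] := jacobson_left_inverse (ideal_mull (val b) rx).
have cb1 : to_corner u c * (1 - b * x) = 1.
  have vz : val (1 - b * x) = (1 - val b * val x) * idem_val u.
    by rewrite mulrBl mul1r -mulrA corner_r.
  apply: val_inj.
  rewrite -[LHS]/(idem_val u * c * idem_val u * val (1 - b * x)).
  by rewrite -!mulrA corner_l vz [c * _]mulrA c1 mul1r idem_mul.
apply: IT; apply/seteqP; split=> // y _.
rewrite -[y]mulr1 -cb1 mulrA; exact: (IZ _ _ Ib).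
Qed.

Lemma jacobson_idempotent (R : pzRingType) (f : R) :
  f * f = f -> ideal_set (jacobson R) f -> f = 0.
Proof.
move=> ff /jacobson_left_inverse [c c1].
by rewrite -[f]mul1r -c1 -mulrA mulrBl mul1r ff subrr mulr0.
Qed.

Lemma orthogonal_sum (R : pzRingType) (s : nat) (eps : 'I_s -> R) (i : 'I_s) :
  (forall i, eps i * eps i = eps i) ->
  (forall i j, i != j -> eps i * eps j = 0) ->
  (\sum_j eps j) * eps i = eps i /\ eps i * (\sum_j eps j) = eps i.
Proof.
move=> ee e0; split.
  rewrite mulr_suml (bigD1 i) //= ee big1 ?addr0 // => j ji; exact: e0.
by rewrite mulr_sumr (bigD1 i) //= ee big1 ?addr0 // => j ji; rewrite e0 // eq_sym.
Qed.

(** If some entry [eps i * x * eps j] were outside the radical of [A], a left multiple of it would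
    be congruent to [eps j]. Then [eps j] would be a nonzero idempotent in the radical of the
    corner. *)
Lemma corner_jacobson_sub (k : fieldType) (A : algType k) (u : idempotent_elt A)
    (s : nat) (eps : 'I_s -> A) (x : corner u) :
  (forall i, eps i * eps i = eps i) -> (forall i j, i != j -> eps i * eps j = 0) ->
  (forall i, eps i != 0) -> idem_val u = \sum_i eps i ->
  (forall i a, ~ ideal_set (jacobson A) (a * eps i) ->
     exists a', ideal_set (jacobson A) (a' * a * eps i - eps i)) ->
  ideal_set (jacobson (corner u)) x -> ideal_set (jacobson A) (val x).
Proof.
move=> ee e0 en0 uE inv rx.
have ul i : idem_val u * eps i = eps i.
  by rewrite uE; case: (orthogonal_sum i ee e0).
have ur i : eps i * idem_val u = eps i.
  by rewrite uE; case: (orthogonal_sum i ee e0).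
rewrite -(eqP (valP x)) uE !mulr_suml; apply: ideal_sum => i _.
rewrite mulr_sumr; apply: ideal_sum => j _; apply: contrapT => nx.
have [a' ax] := inv j _ nx.
pose f := to_corner u (eps j).
have vf : val f = eps j by rewrite /= ul ur.
have ff : f * f = f by apply: val_inj; rewrite -[LHS]/(val f * val f) vf ee.
suff /(jacobson_idempotent ff)/(congr1 val) : ideal_set (jacobson (corner u)) f.
  by rewrite vf => /eqP; apply/negP/en0.
pose y := to_corner u (eps j * a' * eps i).
have vy : val y = eps j * a' * eps i by rewrite /= !mulrA ul -mulrA ur.
apply: (@ideal_congr_mem _ _ (y * x * f)); last first.
  by apply: ideal_mulr; apply: ideal_mull.
apply: ideal_congr_sym; apply: corner_jacobson_sup.
have -> : val (y * x * f - f) = eps j * (a' * (eps i * val x) * eps j - eps j).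
  by rewrite mulrBr ee -[LHS]/(val y * val x * val f - val f) vy vf !mulrA.
exact: ideal_mull.
Qed.

Lemma corner_square_sub (k : fieldType) (A : algType k) (u : idempotent_elt A)
    (x : corner u) :
  (forall y : corner u,
     ideal_set (jacobson (corner u)) y -> ideal_set (jacobson A) (val y)) ->
  ideal_set (ideal_square (jacobson (corner u))) x ->
  ideal_set (ideal_square (jacobson A)) (val x).
Proof.
move=> rval.
suff : ideal_set (ideal_square (jacobson (corner u))) `<=`
    [set x | ideal_set (ideal_square (jacobson A)) (val x)] by apply.
move=> {x}; apply: ideal_square_min.
  split; first split=> [|x y rx ry|x rx] /=.
  - exact: (ideal0 (ideal_square (jacobson A))).
  - exact: (ideal_add (I := ideal_square (jacobson A))).
  - exact: (ideal_opp (I := ideal_square (jacobson A))).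
  - by move=> a x rx; apply: (ideal_mull (I := ideal_square (jacobson A))).
  - by move=> a x rx; apply: (ideal_mulr (I := ideal_square (jacobson A))).
by move=> x y rx ry; apply: ideal_squareM; apply: rval.
Qed.

(* Since the [eps j] sum to [1], [eps i] is the identity of [C i] mod [I]. *)
Lemma component_identity (k : fieldType) (A : algType k) (I : ideal A) (s : nat)
    (C : 'I_s -> set (quotalg I)) (eps : 'I_s -> A) (i : 'I_s)
    (CP : forall j, two_sided_ideal (C j)) :
  sum_of_ideals C -> (forall j, ideal_set (preim_ideal (CP j)) (eps j)) ->
  \sum_j eps j = 1 ->
  forall x, ideal_set (preim_ideal (CP i)) x ->
    ideal_set I (eps i * x - x) /\ ideal_set I (x * eps i - x).
Proof.
move=> sumC Ce e1 x Cx; split; apply: ideal_congr_sym.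
  rewrite -[x in X in ideal_set _ (X - _)]mul1r -e1 mulr_suml.
  rewrite (bigD1 i) //= addrC addrK.
  apply: ideal_sum => j ji; apply/pi_quotalg_eq0.
  apply: (sum_of_ideals_disjoint sumC ji).
    exact: (ideal_mulr (I := preim_ideal (CP j))).
  exact: (ideal_mull (I := preim_ideal (CP i))).
rewrite -[x in X in ideal_set _ (X - _)]mulr1 -e1 mulr_sumr.
rewrite (bigD1 i) //= addrC addrK.
apply: ideal_sum => j ji; apply/pi_quotalg_eq0.
apply: (sum_of_ideals_disjoint sumC ji).
  exact: (ideal_mull (I := preim_ideal (CP j))).
exact: (ideal_mulr (I := preim_ideal (CP i))).
Qed.

(** Carries generators for the basic algebra over to [A]. An ideal of [A] meets the corner in an
    ideal of the corner, and the squared radical of the corner lies in that of [A], so generation in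
    the corner implies generation in [A]. *)
Lemma corner_generators (k : fieldType) (A : algType k) (u : idempotent_elt A)
    (CL CR : set (quotalg (jacobson (corner u))))
    (CLP : two_sided_ideal CL) (CRP : two_sided_ideal CR) (e e' : A) (t : nat) :
  (forall y : corner u,
     ideal_set (jacobson (corner u)) y -> ideal_set (jacobson A) (val y)) ->
  e * e = e -> e' * e' = e' ->
  idem_val u * e * idem_val u = e -> idem_val u * e' * idem_val u = e' ->
  ideal_set (preim_ideal CLP) (to_corner u e) ->
  ideal_set (preim_ideal CRP) (to_corner u e') ->
  (forall x, ideal_set (preim_ideal CLP) x ->
     ideal_set (jacobson (corner u)) (to_corner u e * x - x)) ->
  (forall x, ideal_set (preim_ideal CRP) x ->
     ideal_set (jacobson (corner u)) (x * to_corner u e' - x)) ->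
  generated_by CL CR (arrow_bimodule CL CR) t ->
  exists v : 'I_t -> A,
    [/\ forall l, ideal_set (jacobson A) (v l),
        forall l, e * v l * e' = v l
      & forall x, ideal_set (jacobson A) x ->
          ideal_set (square_ext (jacobson A) v) (e * x * e')].
Proof.
move=> rval ee e'e' ue ue' Ce Ce' eid e'id gen.
have [w [rw wee wgen]] := generated_by_lift eid e'id gen.
have ul x : e * (idem_val u * x) = e * x.
  by rewrite -ue -!mulrA [idem_val u * (idem_val u * x)]mulrA idem_mul.
have ur x : x * idem_val u * e' = x * e'.
  by rewrite -ue' !mulrA -[x * idem_val u * idem_val u]mulrA idem_mul.
pose v l := e * val (w l) * e'; exists v; split=> [l|l|x rx].
- by apply: ideal_mulr; apply: ideal_mull; apply: rval.
- by rewrite /v !mulrA ee -!mulrA e'e'.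
have ZP : two_sided_ideal
    [set y : corner u | ideal_set (square_ext (jacobson A) v) (val y)].
  split; first split=> [|y z vy vz|y vy] /=.
  - exact: (ideal0 (square_ext (jacobson A) v)).
  - exact: (ideal_add (I := square_ext (jacobson A) v)).
  - exact: (ideal_opp (I := square_ext (jacobson A) v)).
  - by move=> a y vy; apply: (ideal_mull (I := square_ext (jacobson A) v)).
  - by move=> a y vy; apply: (ideal_mulr (I := square_ext (jacobson A) v)).
have wZ : ideal_set (square_ext (jacobson (corner u)) w) `<=` ideal_set (Ideal ZP).
  apply: square_ext_min => [y r2y|l].
    exact: square_ext_sq (corner_square_sub rval r2y).
  apply: (@square_ext_congr _ _ _ _ _ (v l)); last exact: square_ext_gen.
  have := corner_square_sub rval (wee l).
  have -> // : val (w l - to_corner u e * w l * to_corner u e') = val (w l) - v l.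
  rewrite -[LHS]/(val (w l) - (idem_val u * e * idem_val u) * val (w l) *
    (idem_val u * e' * idem_val u)).
  by rewrite ue ue'.
have rux : ideal_set (jacobson (corner u)) (to_corner u x).
  have : ideal_set (jacobson A) (idem_val u * x * idem_val u).
    by apply: ideal_mulr; apply: ideal_mull.
  exact: (@corner_jacobson_sup _ _ u (to_corner u x)).
have /wZ := wgen _ _ _ Ce rux Ce'.
have -> // : ideal_set (Ideal ZP) (to_corner u e * to_corner u x * to_corner u e')
  = ideal_set (square_ext (jacobson A) v) (e * x * e').
rewrite -[LHS]/(ideal_set (square_ext (jacobson A) v)
  ((idem_val u * e * idem_val u) * (idem_val u * x * idem_val u) *
    (idem_val u * e' * idem_val u))).
by rewrite ue ue' -!mulrA ul !mulrA ur.
Qed.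

(** * Rounded-up quotients of natural numbers *)

Lemma ceil_div_leq (m c N : nat) : (0 < N)%N -> (m <= c * N)%N ->
  Num.ceil (m%:Q / N%:Q) <= c%:Z.
Proof.
move=> N0 mc; rewrite ceil_le_int ler_pdivrMr ?ltr0n //.
by rewrite -!pmulrn -natrM ler_nat.
Qed.

(** With [ceil_div_leq] this describes the ceiling as the least [c] with [m <= c * N], the form in
    which packing delivers its bounds. *)
Lemma leq_ceil_div (t m N : nat) : (0 < N)%N ->
  (forall c, (m <= c * N)%N -> (t <= c)%N) -> t%:Z <= Num.ceil (m%:Q / N%:Q).
Proof.
move=> N0 mt.
have c0 : 0 <= Num.ceil (m%:Q / N%:Q).
  by rewrite -(@ceil0 rat); apply: ceil_le; rewrite divr_ge0 ?ler0n.
have := ceil_ge (m%:Q / N%:Q); case: (Num.ceil _) c0 => // c _.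
rewrite ler_pdivrMr ?ltr0n // -!pmulrn -natrM ler_nat => /mt.
by rewrite lez_nat.
Qed.

(** If [e *: z] were nonzero, it would generate [S i], and an element of [C i] acting nontrivially
    would give one of both [C i] and [C j] that still does. Such an element is in the radical. *)
Lemma idempotent_kills (k : fieldType) (A : algType k) (s : nat)
    (S : 'I_s -> lmodType A) (n : 'I_s -> nat)
    (C : 'I_s -> set (quotalg (jacobson A))) (CP : forall i, two_sided_ideal (C i))
    (e f : A) (i j : 'I_s) (s0 : S i) :
  is_wedderburn S n C -> simple_module (S i) -> top_generator f s0 ->
  ideal_set (preim_ideal (CP j)) e -> i != j -> forall z : S i, e *: z = 0.
Proof.
move=> [sumC actC _] simS s0P Ce ij z.
have [a [y [Ca ay]]] := actC i.
apply/eqP; apply: contrapT => /negP ez; have [c yc] := simple_cyclic y simS ez.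
case/eqP: ay; rewrite yc !scalerA; apply: (jacobson_top_generator _ s0P).
apply/pi_quotalg_eq0; apply: (sum_of_ideals_disjoint sumC ij).
  by do 2 apply: (ideal_mulr (I := preim_ideal (CP i))).
exact: (ideal_mull (I := preim_ideal (CP j))).
Qed.

(** The coefficients are scalar multiples of [1], whence the commutation that [diagram_bound] asks
    for. *)
Lemma corner_basis (k : fieldType) (A : algType k) (u : idempotent_elt A)
    (C : set (quotalg (jacobson (corner u)))) (CP : two_sided_ideal C)
    (e : A) (M : lmodType A) (d : nat) :
  (forall y : corner u,
     ideal_set (jacobson (corner u)) y -> ideal_set (jacobson A) (val y)) ->
  e * e = e -> idem_val u * e = e -> e * idem_val u = e ->
  ideal_set (preim_ideal CP) (to_corner u e) ->
  ideal_iso C (fun (c : k) (g : endo M) => c *: g) ->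
  has_basis (endo M) d ->
  exists b : 'I_d -> A, forall y, exists2 c : 'I_d -> A,
    forall q x, c q * x = x * c q &
    ideal_set (jacobson A) (e * y * e - \sum_q c q * b q).
Proof.
move=> rval ee ue eu Ce [f [fD _ fZ _ f_ran]] [g gP].
set Q := quotalg _ in f fD fZ f_ran.
have f0 : f 0 = 0 by apply: (addIr (f 0)); rewrite -fD !add0r.
exists (fun q => val (repr (f (g q)))) => y.
pose z := to_corner u (e * y * e).
have vz : val z = e * y * e by rewrite /= !mulrA ue -mulrA eu.
have Cz : C (\pi_Q z).
  have -> : z = z * to_corner u e.
    apply: val_inj; rewrite -[RHS]/(val z * (idem_val u * e * idem_val u)) ue eu vz.
    by rewrite -!mulrA ee.
  exact: (ideal_mull (I := preim_ideal CP)).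
move: Cz; rewrite -f_ran => -[g0 _ fg0]; have [c [g0c _]] := gP g0.
exists (fun q => (c 0 q)%:A) => [q x|]; first by rewrite mulr_algl mulr_algr.
have : ideal_set (jacobson (corner u)) (z - \sum_q c 0 q *: repr (f (g q))).
  apply/quotalg_eqP; rewrite -/Q -fg0 g0c pi_quotalg_sum (big_morph f fD f0).
  by apply: eq_bigr => q _; rewrite fZ pi_quotalgZ reprK.
move=> /rval; congr (ideal_set _ _).
rewrite -[LHS]/(val z - val (\sum_q c 0 q *: repr (f (g q)))) vz.
congr (_ - _); rewrite (big_morph val (op1 := +%R) (id1 := 0)) //.
by apply: eq_bigr => q _; rewrite mulr_algl.
Qed.

Theorem theorem5p3 (k : fieldType) (A : algType k)
  (artinA : left_artinian A)
  (s : nat) (S : 'I_s -> lmodType A) (simpleS : complete_simple_modules S)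
  (n : 'I_s -> nat) (CA : 'I_s -> set (quotalg (jacobson A)))
  (wedA : is_wedderburn S n CA)
  (P : 'I_s -> lmodType A)
  (projP : forall i, projective_module (P i))
  (indecP : forall i, indecomposable_module (P i))
  (topP : forall i, mod_iso (quotmod (ideal_act (jacobson A) (P i))) (S i))
  (eps : 'I_s -> A) (idemE : basic_idempotents P eps)
  (e : idempotent_elt A) (sumE : idem_val e = \sum_i eps i)
  (CB : 'I_s -> set (quotalg (jacobson (corner e))))
  (wedB : is_basic_wedderburn S eps CB)
  (tA tB hA : 'I_s -> 'I_s -> nat)
  (quivA : is_natural_quiver CA tA)
  (quivB : is_natural_quiver CB tB)
  (diagA : is_diagram S P hA)
  (i j : 'I_s) :
  ((tA i j)%:Z <= Num.ceil ((tB i j)%:Q / (n i * n j)%N%:Q) <= (tB i j)%:Z)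
  /\
  ((tA i j)%:Z <= Num.ceil ((hA i j)%:Q / (n i * n j)%N%:Q)
   /\ ((Num.ceil ((hA i j)%:Q / (n i * n j)%N%:Q))%:E
       <= (tA i j)%:Z%:E * dimk (endo (S i)))%E).
Proof.
have [idem orth topiso] := idemE; have [simS _ _] := simpleS.
have [sumA actA isoA] := wedA; have [sumB epsB isoB] := wedB.
have CAP l : two_sided_ideal (CA l) := proj1 sumA l.
have CBP l : two_sided_ideal (CB l) := proj1 sumB l.
have ee l : eps l * eps l = eps l by case: (idem l).
have en0 l : eps l != 0 by case: (idem l).
have top l := cid (top_generatorP (ee l) (topiso l) (topP l)).
have s0P l : top_generator (eps l) (sval (top l)) by exact: svalP.
have ne l := top_generator_notin (simS l) (ee l) (s0P l).
have inv l := top_generator_inv (simS l) (s0P l).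
have epsA l : ideal_set (preim_ideal (CAP l)) (eps l).
  exact: idempotent_in_component (simS l) (s0P l) (actA l).
have [p [q [Cp Cq qp idL idLr]]] :=
  matrix_units (simS j) (ee j) (s0P j) (epsA j) (isoA j).
have [p' [q' [Cp' Cq' q'p' idRl idR]]] :=
  matrix_units (simS i) (ee i) (s0P i) (epsA i) (isoA i).
(* For [n l = 0] the identity of the component would be an empty sum, which puts [eps l] in the
   radical. *)
have n_gt0 l : (0 < n l)%N.
  have [pl [ql [_ _ _ idl _]]] :=
    matrix_units (simS l) (ee l) (s0P l) (epsA l) (isoA l).
  rewrite lt0n; apply/negP => /eqP nl0; apply: (ne l).
  have := idl _ (epsA l); rewrite big1 => [|a _].
    by rewrite mul0r sub0r => /ideal_opp; rewrite opprK.
  by have := ltn_ord a; rewrite [X in (_ < X)%N]nl0.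
have N_gt0 : (0 < n i * n j)%N by rewrite muln_gt0 !n_gt0.
have rval := corner_jacobson_sub ee orth en0 sumE inv.
have unitL : ideal_set (preim_ideal (CAP j)) (\sum_a p a * eps j * q a).
  apply: ideal_sum => a _; apply: (ideal_mull (I := preim_ideal (CAP j))).
  exact: Cq.
have unitR : ideal_set (preim_ideal (CAP i)) (\sum_a p' a * eps i * q' a).
  apply: ideal_sum => a _; apply: (ideal_mull (I := preim_ideal (CAP i))).
  exact: Cq'.
(* Both lower bounds of ceilings come from this packing step: once for generators from [B], once for
   the basis [U]. *)
have t_le m (v : 'I_m -> A) c :
    (forall l, ideal_set (jacobson A) (v l)) ->
    (forall l, eps j * v l * eps i = v l) ->
    (forall x, ideal_set (jacobson A) x ->
       ideal_set (square_ext (jacobson A) v) (eps j * x * eps i)) ->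
    (m <= c * (n i * n j))%N -> (tA i j <= c)%N.
  move=> rv ev vgen; rewrite [(n i * _)%N]mulnC => mc; apply: (proj2 (quivA i j)).
  have [w [rw Ww wv]] := pack_generators Cp Cq' qp q'p' rv ev mc.
  apply: (generated_byI unitL unitR idL idR rw Ww).
  apply: (component_cover _ idLr idRl) => [|x rx]; first exact: square_ext_sq.
  apply: (@square_ext_min _ _ (square_ext (jacobson A) w) _ v) => //.
    exact: square_ext_sq.
  exact: vgen.
have ue l : idem_val e * eps l = eps l.
  by rewrite sumE; case: (orthogonal_sum l ee orth).
have eu l : eps l * idem_val e = eps l.
  by rewrite sumE; case: (orthogonal_sum l ee orth).
have [v [rv ev vgen]] : exists v : 'I_(tB i j) -> A,
    [/\ forall l, ideal_set (jacobson A) (v l),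
        forall l, eps j * v l * eps i = v l
      & forall x, ideal_set (jacobson A) x ->
          ideal_set (square_ext (jacobson A) v) (eps j * x * eps i)].
  have sum1 : \sum_l to_corner e (eps l) = 1.
    apply: val_inj; rewrite (big_morph val (op1 := +%R) (id1 := 0)) //.
    by rewrite -[RHS]/(idem_val e) sumE; apply: eq_bigr => l _; rewrite /= ue eu.
  apply: (corner_generators (CLP := CBP j) (CRP := CBP i) rval);
    rewrite ?ue ?eu ?ee //.
  - by move=> x Cx; case: (component_identity sumB epsB sum1 Cx).
  - by move=> x Cx; case: (component_identity sumB epsB sum1 Cx).
  - exact: (proj1 (quivB i j)).
have [U [rU eU Ugen Ufree]] := diagram_basis (ee j) (s0P j)
  (fun j' j'j => idempotent_kills wedA (simS j') (s0P j') (epsA j) j'j)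
  (ee i) (topiso i) (diagA i).
split; [apply/andP; split|split].
- by apply: leq_ceil_div => // c; exact: t_le rv ev vgen.
- by apply: ceil_div_leq => //; rewrite leq_pmulr.
- apply: leq_ceil_div => // c; apply: (t_le _ _ _ rU eU) => x rx.
  have [a aU] := Ugen x rx; apply: square_ext_congr aU _.
  by apply: ideal_sum => l _; apply: ideal_mull; apply: square_ext_gen.
have [w [rw wu wgen]] := generated_by_lift idL idR (proj1 (quivA i j)).
pose V (x : 'I_(tA i j) * ('I_(n j) * 'I_(n i))) :=
  eps j * (q x.2.1 * w x.1 * p' x.2.2) * eps i.
have rV x : ideal_set (jacobson A) (V x).
  by do 2 (apply: ideal_mulr; apply: ideal_mull).
have eV x : eps j * V x * eps i = V x by rewrite /V !mulrA ee -!mulrA ee.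
have Vgen x : ideal_set (jacobson A) x ->
    ideal_set (square_ext (jacobson A) V) (eps j * x * eps i).
  by move=> rx; apply: (unpack_generators wu); apply: wgen.
(* Without arrows in the natural quiver, [eps j * r * eps i] lies in the squared radical, and
   freeness leaves no room for [U]. This settles the case of infinite dimension, where the
   right-hand side is [0]. *)
have h0 : tA i j = 0%N -> hA i j = 0%N.
  move=> t0; apply/eqP; rewrite -leqn0 leqNgt; apply/negP => h_gt0.
  pose l0 := Ordinal h_gt0; apply: (ne j).
  have /Ufree/(_ l0) : ideal_set (ideal_square (jacobson A))
      (\sum_l (if l == l0 then eps j else 0) * U l).
    apply: ideal_sum => l _; case: eqP => [->|_]; last first.
      by rewrite mul0r; apply: ideal0.
    have sq : ideal_set (square_ext (jacobson A) V) `<=`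
        ideal_set (ideal_square (jacobson A)).
      by apply: square_ext_min => // -[[a lt_a] c]; exfalso; rewrite t0 in lt_a.
    by apply: ideal_mull; rewrite -eU; apply: sq; apply: Vgen; apply: rU.
  by rewrite eqxx ee.
(* Either there is a basis with [d] elements, or [dimk] takes its default [+oo] and only the
   vanishing of [tA i j] matters. *)
rewrite /dimk; case: xgetP => [x _ [d basis_d ->]|_].
  have [b bP] :=
    corner_basis (CP := CBP i) rval (ee i) (ue i) (eu i) (epsB i) (isoB i)
      basis_d.
  have := diagram_bound (ee j) (ee i) (ne j) (inv j) rU eU Ufree rV eV Vgen bP.
  rewrite !card_prod !card_ord => h_le.
  rewrite -EFinM lee_fin -PoszM; apply: ceil_div_leq => //.
  by rewrite (leq_trans h_le) // [(n i * _)%N]mulnC -!mulnA [(d * _)%N]mulnC -!mulnA.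
have [t0|t_gt0] := posnP (tA i j); last first.
  by rewrite gt0_muley ?leey // lte_fin ltz_nat.
rewrite t0 mul0e lee_fin; apply: (@ceil_div_leq _ 0) => //.
by rewrite h0.
Qed.
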